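(* Let $\mathcal{AG}_{ua}$ be the category of archimedean abelian lattice-ordered groups with strong unit, $\mathcal{RS}_{ua}$ the category of archimedean Riesz spaces with strong unit, $\mathcal{MV}_s$ the category of semisimple MV-algebras and $\mathcal{RMV}_s$ the category of semisimple Riesz MV-algebras. Let $\Gamma:\mathcal{AG}_{ua}\to\mathcal{MV}_s$ and $\Gamma_R:\mathcal{RS}_{ua}\to\mathcal{RMV}_s$ be the unit-interval functors, and let $\mathbf R:\mathcal{AG}_{ua}\to\mathcal{RS}_{ua}$ and $\mathbf R:\mathcal{MV}_s\to\mathcal{RMV}_s$ be the hull functors. Then the square formed by these functors commutes, i.e. $\mathbf R\circ\Gamma=\Gamma_R\circ\mathbf R$ as functors $\mathcal{AG}_{ua}\to\mathcal{RMV}_s$ (up to natural isomorphism).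
   Context: An MV-algebra is a structure $(A,\oplus,{}^*,0)$ such that $(A,\oplus,0)$ is an abelian monoid, $(a^* )^*=a$, $0^*\oplus a=0^*$ and $(a^*\oplus b)^*\oplus b=(b^*\oplus a)^*\oplus a$. Put $a\odot b=(a^*\oplus b^* )^*$; $a\le b$ iff $a\odot b^*=0$. It is semisimple if the intersection of its maximal ideals is $\{0\}$ (ideal: nonempty downward closed subset closed under $\oplus$). A Riesz MV-algebra is an MV-algebra $V$ with a map $\cdot:[0,1]\times V\to V$ such that $r(a\odot b^* )=(ra)\odot(rb)^*$, $\max(r-q,0)\,a=(ra)\odot(qa)^*$, $(rq)a=r(qa)$, $1a=a$ for all $r,q\in[0,1]$, $a,b\in V$; it is semisimple if its MV-reduct is. Morphisms in $\mathcal{MV}_s$ and $\mathcal{RMV}_s$ are MV-homomorphisms (they automatically preserve scalar multiplication between Riesz MV-algebras). Objects of $\mathcal{AG}_{ua}$ are pairs $(G,u)$ with $G$ an abelian $\ell$-group that is archimedean ($nx\le y$ for all $n\in\mathbb N$ implies $x\le0$) and $u\ge 0$ a strong unit (every $x\in G$ satisfies $x\le nu$ for some $n$); morphisms are unit-preserving $\ell$-group homomorphisms. Objects of $\mathcal{RS}_{ua}$ are archimedean Riesz spaces (real vector lattices) with strong unit; morphisms are unit-preserving linear lattice homomorphisms. $\Gamma(G,u)=[0,u]$ with $x\oplus y=(x+y)\wedge u$, $x^*=u-x$; $\Gamma_R(L,u)$ is the same with scalar multiplication restricted to $[0,1]$; both functors act on morphisms by restriction to $[0,u]$. Hull of groups: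 for an archimedean $\ell$-group $G$, $G_d=\{g/n\mid g\in G,\ n\ge1\}$ is its divisible hull, $\widehat{G_d}$ the Dedekind-MacNeille (conditional) completion of $G_d$, which is a Riesz space, and $\mathbf R(G)$ is the Riesz subspace of $\widehat{G_d}$ generated by $G_d$. If $u$ is a strong unit of $G$, it is a strong unit of $\mathbf R(G)$, and $\mathbf R(G,u)=(\mathbf R(G),u)$; on a morphism $h:(G,u)\to(H,v)$, $\mathbf R(h)$ is the unique morphism $\mathbf R(G)\to\mathbf R(H)$ extending $h$. Hull of MV-algebras: if $A=\Gamma(G,u)$ is semisimple, its divisible hull is $A_d=\Gamma(G_d,u)$. The Dedekind-MacNeille completion $\hat B$ of a semisimple MV-algebra $B$ is the (unique up to isomorphism) MV-algebra containing $B$ as a subalgebra, complete as a lattice, in which every element is a supremum of elements of $B$. $\widehat{A_d}$ carries a (unique) Riesz MV-algebra structure; $\mathbf R(A)$ is the Riesz MV-subalgebra of $\widehat{A_d}$ generated by the image of $A$, with canonical embedding $\iota_A:A\to\mathbf R(A)$. For an MV-homomorphism $h:A\to B$, $\mathbf R(h):\mathbf R(A)\to\mathbf R(B)$ is the unique homomorphism with $\mathbf R(h)\circ\iota_A=\iota_B\circ h$. *)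

(* Defs.v *)
From HB Require Import structures.
From mathcomp Require Import all_boot all_order all_algebra.
From mathcomp Require Import boolp classical_sets reals interval_inference.

Set Implicit Arguments.
Unset Strict Implicit.
Unset Printing Implicit Defensive.

Import Order.TTheory GRing.Theory Num.Theory.

Local Open Scope classical_set_scope.
Local Open Scope ring_scope.

Declare Scope lg_scope.
Delimit Scope lg_scope with LG.
Declare Scope mv_scope.
Delimit Scope mv_scope with MV.

Record category : Type := Category {
  obj :> Type;
  hom : obj -> obj -> Type;
  idm : forall X, hom X X;
  comp : forall X Y Z, hom Y Z -> hom X Y -> hom X Z;
  comp_idl : forall X Y (f : hom X Y), comp (idm Y) f = f;
  comp_idr : forall X Y (f : hom X Y), comp f (idm X) = f;
  compA : forall X Y Z T (h : hom Z T) (g : hom Y Z) (f : hom X Y),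
    comp h (comp g f) = comp (comp h g) f }.

Arguments idm {c} X.
Arguments comp {c X Y Z} g f.

Record functor (C D : category) : Type := Functor {
  fobj :> C -> D;
  fmap : forall X Y : C, hom X Y -> hom (fobj X) (fobj Y);
  fmap_id : forall X : C, fmap (idm X) = idm (fobj X);
  fmap_comp : forall (X Y Z : C) (g : hom Y Z) (f : hom X Y),
    fmap (comp g f) = comp (fmap g) (fmap f) }.

Arguments fmap {C D} F {X Y} f : rename.

Section FunctorComposition.
Variables (C D E : category) (G : functor D E) (F : functor C D).

Fact fcomp_id (X : C) : fmap G (fmap F (idm X)) = idm (G (F X)).
Proof. by rewrite !fmap_id. Qed.

Fact fcomp_comp (X Y Z : C) (g : hom Y Z) (f : hom X Y) :
  fmap G (fmap F (comp g f)) = comp (fmap G (fmap F g)) (fmap G (fmap F f)).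
Proof. by rewrite !fmap_comp. Qed.

Definition fcomp : functor C E :=
  @Functor C E (fun X => G (F X)) (fun X Y f => fmap G (fmap F f))
    fcomp_id fcomp_comp.

End FunctorComposition.

Definition is_iso (C : category) (X Y : C) (f : hom X Y) : Prop :=
  exists g : hom Y X, comp g f = idm X /\ comp f g = idm Y.

Definition naturally_isomorphic (C D : category) (F G : functor C D) : Prop :=
  exists eta : forall X : C, hom (F X) (G X),
    (forall X, is_iso (eta X)) /\
    (forall (X Y : C) (f : hom X Y),
       comp (eta Y) (fmap F f) = comp (fmap G f) (eta X)).

(* The lattice operations are added on top of [porderZmodType] because       *)
(* Hierarchy-Builder does not accept a join of [Order.Lattice] and            *)
(* [GRing.Zmodule] declared after [Num.RealDomain].                           *)
HB.mixin Record POrderedZmodule_isLGroup G of Num.POrderedZmodule G := {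
  lgmeet : G -> G -> G;
  lgjoin : G -> G -> G;
  lg_leD2r : forall z x y : G, x <= y -> x + z <= y + z;
  lg_lexI : forall x y z : G, (x <= lgmeet y z) = (x <= y) && (x <= z);
  lg_leUx : forall x y z : G, (lgjoin x y <= z) = (x <= z) && (y <= z) }.

#[short(type="lgroupType")]
HB.structure Definition LGroup :=
  { G of POrderedZmodule_isLGroup G & Num.POrderedZmodule G }.

Notation "x ∧ y" := (lgmeet x y) (at level 48, left associativity) : lg_scope.
Notation "x ∨ y" := (lgjoin x y) (at level 52, left associativity) : lg_scope.
Local Open Scope lg_scope.

HB.mixin Record LGroup_Lmodule_isRiesz (R : realType) L
    of LGroup L & GRing.Lmodule R L := {
  rs_scale_ge0 : forall (a : R) (x : L), 0 <= a -> 0 <= x -> 0 <= a *: x }.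

#[short(type="rieszType")]
HB.structure Definition RieszSpace (R : realType) :=
  { L of LGroup_Lmodule_isRiesz R L & LGroup L & GRing.Lmodule R L }.

Definition archimedean (G : lgroupType) : Prop :=
  forall x y : G, (forall n, x *+ n <= y) -> x <= 0.

Definition strong_unit (G : lgroupType) (u : G) : Prop :=
  0 <= u /\ forall x : G, exists n, x <= u *+ n.

Definition lgroup_hom (G H : lgroupType) (f : G -> H) : Prop :=
  [/\ {morph f : x y / x + y}, {morph f : x y / x ∧ y}
    & {morph f : x y / x ∨ y}].

Definition riesz_hom (R : realType) (L M : rieszType R) (f : L -> M) : Prop :=
  lgroup_hom f /\ forall a : R, {morph f : x / a *: x}.

HB.mixin Record isMVAlgebra (A : Type) := {
  mvzero : A;
  mvplus : A -> A -> A;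
  mvneg : A -> A;
  mvplusA : forall a b c, mvplus a (mvplus b c) = mvplus (mvplus a b) c;
  mvplusC : forall a b, mvplus a b = mvplus b a;
  mvplus0 : forall a, mvplus a mvzero = a;
  mvnegK : forall a, mvneg (mvneg a) = a;
  mvplus1 : forall a, mvplus (mvneg mvzero) a = mvneg mvzero;
  mv_luk : forall a b,
    mvplus (mvneg (mvplus (mvneg a) b)) b =
    mvplus (mvneg (mvplus (mvneg b) a)) a }.

#[short(type="mvAlgType")]
HB.structure Definition MVAlgebra := { A of isMVAlgebra A }.

Notation "a ⊕ b" := (mvplus a b) (at level 50, left associativity) : mv_scope.

Definition mvtimes (A : mvAlgType) (a b : A) : A :=
  mvneg (mvneg a ⊕ mvneg b)%MV.

Notation "a ⊙ b" := (mvtimes a b) (at level 40, left associativity) : mv_scope.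

Definition mvle (A : mvAlgType) (a b : A) : Prop := (a ⊙ mvneg b)%MV = mvzero.

Definition mv_ideal (A : mvAlgType) (I : set A) : Prop :=
  [/\ I !=set0, forall a b, mvle a b -> I b -> I a
    & forall a b, I a -> I b -> I (a ⊕ b)%MV].

Definition mv_maximal (A : mvAlgType) (I : set A) : Prop :=
  [/\ mv_ideal I, I <> setT
    & forall J : set A, mv_ideal J -> J <> setT -> I `<=` J -> J = I].

Definition mv_semisimple (A : mvAlgType) : Prop :=
  \bigcap_(I in @mv_maximal A) I = [set mvzero].

HB.mixin Record MVAlgebra_isRieszMV (R : realType) V of MVAlgebra V := {
  mvscale : {i01 R} -> V -> V;
  mvscale_sub : forall r (a b : V),
    mvscale r (a ⊙ mvneg b)%MV = (mvscale r a ⊙ mvneg (mvscale r b))%MV;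
  mvscale_subl : forall (r q : {i01 R}) (a : V),
    mvscale (Num.max (r%:num - q%:num) 0)%:i01 a =
    (mvscale r a ⊙ mvneg (mvscale q a))%MV;
  mvscaleA : forall (r q : {i01 R}) (a : V),
    mvscale (r%:num * q%:num)%:i01 a = mvscale r (mvscale q a);
  mvscale1 : forall a : V, mvscale 1%:i01 a = a }.

#[short(type="rieszMVType")]
HB.structure Definition RieszMV (R : realType) :=
  { V of MVAlgebra_isRieszMV R V & MVAlgebra V }.

Definition mv_hom (A B : mvAlgType) (f : A -> B) : Prop :=
  [/\ f mvzero = mvzero, {morph f : a b / (a ⊕ b)%MV}
    & {morph f : a / mvneg a}].

Definition mv_iso (A B : mvAlgType) (f : A -> B) : Prop :=
  mv_hom f /\ bijective f.

Record ssMV : Type := SsMV {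
  ss_sort :> mvAlgType;
  ss_semisimple : mv_semisimple ss_sort }.

Record ssRieszMV (R : realType) : Type := SsRieszMV {
  ssr_sort :> rieszMVType R;
  ssr_semisimple : mv_semisimple ssr_sort }.

Record mvHom (A B : mvAlgType) : Type := MVHom {
  mvhom_fun :> A -> B;
  mvhomP : mv_hom mvhom_fun }.

Record uaGroup : Type := UAGroup {
  uag_sort :> lgroupType;
  uag_unit : uag_sort;
  uag_archimedean : archimedean uag_sort;
  uag_strong_unit : strong_unit uag_unit }.

Record uaGroupHom (G H : uaGroup) : Type := UAGroupHom {
  uaghom_fun :> G -> H;
  uaghomP : lgroup_hom uaghom_fun;
  uaghom_unit : uaghom_fun (uag_unit G) = uag_unit H }.

Record uaRiesz (R : realType) : Type := UARiesz {
  uar_sort :> rieszType R;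
  uar_unit : uar_sort;
  uar_archimedean : archimedean uar_sort;
  uar_strong_unit : strong_unit uar_unit }.

Record uaRieszHom (R : realType) (L M : uaRiesz R) : Type := UARieszHom {
  uarhom_fun :> L -> M;
  uarhomP : riesz_hom uarhom_fun;
  uarhom_unit : uarhom_fun (uar_unit L) = uar_unit M }.

Lemma mvHom_eq (A B : mvAlgType) (f g : mvHom A B) : f =1 g -> f = g.
Proof.
case: f g => [f hf] [g hg] /= /funext fg; case: _ / fg in hg *.
by congr MVHom.
Qed.

Lemma uaGroupHom_eq (G H : uaGroup) (f g : uaGroupHom G H) : f =1 g -> f = g.
Proof.
case: f g => [f hf uf] [g hg ug] /= /funext fg; case: _ / fg in hg ug *.
by congr UAGroupHom.
Qed.

Lemma uaRieszHom_eq (R : realType) (L M : uaRiesz R) (f g : uaRieszHom L M) :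
  f =1 g -> f = g.
Proof.
case: f g => [f hf uf] [g hg ug] /= /funext fg; case: _ / fg in hg ug *.
by congr UARieszHom.
Qed.

Fact mv_hom_id (A : mvAlgType) : mv_hom (@id A). Proof. by []. Qed.

Fact mv_hom_comp (A B C : mvAlgType) (g : B -> C) (f : A -> B) :
  mv_hom g -> mv_hom f -> mv_hom (g \o f).
Proof.
case=> g0 gD gN [f0 fD fN]; split=> [|a b|a] /=.
- by rewrite f0.
- by rewrite fD gD.
- by rewrite fN gN.
Qed.

Fact lgroup_hom_id (G : lgroupType) : lgroup_hom (@id G). Proof. by []. Qed.

Fact lgroup_hom_comp (G H K : lgroupType) (g : H -> K) (f : G -> H) :
  lgroup_hom g -> lgroup_hom f -> lgroup_hom (g \o f).
Proof.
case=> gD gI gU [fD fI fU]; split=> a b /=.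
- by rewrite fD gD.
- by rewrite fI gI.
- by rewrite fU gU.
Qed.

Fact riesz_hom_id (R : realType) (L : rieszType R) : riesz_hom (@id L).
Proof. by []. Qed.

Fact riesz_hom_comp (R : realType) (L M N : rieszType R)
    (g : M -> N) (f : L -> M) :
  riesz_hom g -> riesz_hom f -> riesz_hom (g \o f).
Proof.
case=> hg gZ [hf fZ]; split; first exact: lgroup_hom_comp.
by move=> a x /=; rewrite fZ gZ.
Qed.

Definition mvid (A : mvAlgType) : mvHom A A := MVHom (mv_hom_id A).

Definition mvcomp (A B C : mvAlgType) (g : mvHom B C) (f : mvHom A B) :
  mvHom A C := MVHom (mv_hom_comp (mvhomP g) (mvhomP f)).

Definition uagid (G : uaGroup) : uaGroupHom G G :=
  UAGroupHom (lgroup_hom_id G) (erefl (uag_unit G)).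

Definition uagcomp (G H K : uaGroup) (g : uaGroupHom H K)
    (f : uaGroupHom G H) : uaGroupHom G K :=
  @UAGroupHom G K (g \o f) (lgroup_hom_comp (uaghomP g) (uaghomP f))
    (etrans (congr1 g (uaghom_unit f)) (uaghom_unit g)).

Definition uarid (R : realType) (L : uaRiesz R) : uaRieszHom L L :=
  UARieszHom (riesz_hom_id L) (erefl (uar_unit L)).

Definition uarcomp (R : realType) (L M N : uaRiesz R) (g : uaRieszHom M N)
    (f : uaRieszHom L M) : uaRieszHom L N :=
  @UARieszHom R L N (g \o f) (riesz_hom_comp (uarhomP g) (uarhomP f))
    (etrans (congr1 g (uarhom_unit f)) (uarhom_unit g)).

Section CategoryLaws.
Variable R : realType.

Fact mvcomp_idl (A B : mvAlgType) (f : mvHom A B) : mvcomp (mvid B) f = f.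
Proof. exact: mvHom_eq. Qed.

Fact mvcomp_idr (A B : mvAlgType) (f : mvHom A B) : mvcomp f (mvid A) = f.
Proof. exact: mvHom_eq. Qed.

Fact mvcompA (A B C D : mvAlgType) (h : mvHom C D) (g : mvHom B C)
    (f : mvHom A B) : mvcomp h (mvcomp g f) = mvcomp (mvcomp h g) f.
Proof. exact: mvHom_eq. Qed.

Fact uagcomp_idl (G H : uaGroup) (f : uaGroupHom G H) :
  uagcomp (uagid H) f = f.
Proof. exact: uaGroupHom_eq. Qed.

Fact uagcomp_idr (G H : uaGroup) (f : uaGroupHom G H) :
  uagcomp f (uagid G) = f.
Proof. exact: uaGroupHom_eq. Qed.

Fact uagcompA (G H K L : uaGroup) (h : uaGroupHom K L) (g : uaGroupHom H K)
    (f : uaGroupHom G H) : uagcomp h (uagcomp g f) = uagcomp (uagcomp h g) f.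
Proof. exact: uaGroupHom_eq. Qed.

Fact uarcomp_idl (L M : uaRiesz R) (f : uaRieszHom L M) :
  uarcomp (uarid M) f = f.
Proof. exact: uaRieszHom_eq. Qed.

Fact uarcomp_idr (L M : uaRiesz R) (f : uaRieszHom L M) :
  uarcomp f (uarid L) = f.
Proof. exact: uaRieszHom_eq. Qed.

Fact uarcompA (L M N P : uaRiesz R) (h : uaRieszHom N P)
    (g : uaRieszHom M N) (f : uaRieszHom L M) :
  uarcomp h (uarcomp g f) = uarcomp (uarcomp h g) f.
Proof. exact: uaRieszHom_eq. Qed.

End CategoryLaws.

Definition AGua : category := @Category uaGroup uaGroupHom
  uagid uagcomp uagcomp_idl uagcomp_idr uagcompA.

Definition RSua (R : realType) : category :=
  @Category (uaRiesz R) (@uaRieszHom R) (@uarid R) (@uarcomp R)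
    (@uarcomp_idl R) (@uarcomp_idr R) (@uarcompA R).

Definition MVs : category := @Category ssMV (fun A B => mvHom A B)
  (fun A => mvid A) (fun _ _ _ g f => mvcomp g f)
  (fun _ _ _ => mvcomp_idl _) (fun _ _ _ => mvcomp_idr _)
  (fun _ _ _ _ _ _ _ => mvcompA _ _ _).

(* Morphisms are not required to preserve scalars: MV-homomorphisms between   *)
(* semisimple Riesz MV-algebras do so automatically.                          *)
Definition RMVs (R : realType) : category :=
  @Category (ssRieszMV R) (fun V W => mvHom V W)
    (fun V => mvid V) (fun _ _ _ g f => mvcomp g f)
    (fun _ _ _ => mvcomp_idl _) (fun _ _ _ => mvcomp_idr _)
    (fun _ _ _ _ _ _ _ => mvcompA _ _ _).

Definition uaGroup_of_uaRiesz (R : realType) (L : uaRiesz R) : uaGroup :=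
  UAGroup (@uar_archimedean R L) (@uar_strong_unit R L).

Definition uaGroupHom_of_uaRieszHom (R : realType) (L M : uaRiesz R)
    (f : uaRieszHom L M) :
  uaGroupHom (uaGroup_of_uaRiesz L) (uaGroup_of_uaRiesz M) :=
  @UAGroupHom (uaGroup_of_uaRiesz L) (uaGroup_of_uaRiesz M) f
    (proj1 (uarhomP f)) (uarhom_unit f).

Section LGroupTheory.
Variable G : lgroupType.
Implicit Types x y z : G.

Lemma lg_lerD2r z x y : (x + z <= y + z) = (x <= y).
Proof.
apply/idP/idP => [h|]; last exact: lg_leD2r.
by have := lg_leD2r (- z) _ _ h; rewrite !addrK.
Qed.

Lemma lg_lerD2l z x y : (z + x <= z + y) = (x <= y).
Proof. by rewrite ![z + _]addrC lg_lerD2r. Qed.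

Lemma lg_lerDl x y : (x <= x + y) = (0 <= y).
Proof. by rewrite -{1}[x]addr0 lg_lerD2l. Qed.

Lemma lg_leD x y z t : x <= y -> z <= t -> x + z <= y + t.
Proof.
move=> xy zt; apply: (@le_trans _ _ (y + z)); first by rewrite lg_lerD2r.
by rewrite lg_lerD2l.
Qed.

Lemma lg_subr_ge0 x y : (0 <= y - x) = (x <= y).
Proof. by rewrite -[RHS](lg_lerD2r (- x)) subrr. Qed.

Lemma lg_lerBl x y z : (x - y <= z) = (x <= z + y).
Proof. by rewrite -[LHS](lg_lerD2r y) subrK. Qed.

Lemma lg_lerBr x y z : (x <= y - z) = (x + z <= y).
Proof. by rewrite -[LHS](lg_lerD2r z) subrK. Qed.

Lemma lg_lerN2 x y : (- x <= - y) = (y <= x).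
Proof. by rewrite -[LHS](lg_lerD2r (x + y)) addKr addrCA addNr addr0. Qed.

Lemma lg_eq_le x y : (forall z, (z <= x) = (z <= y)) -> x = y.
Proof. by move=> h; apply/le_anti; rewrite -h lexx h lexx. Qed.

Lemma lg_eq_ge x y : (forall z, (x <= z) = (y <= z)) -> x = y.
Proof. by move=> h; apply/le_anti; rewrite h lexx -h lexx. Qed.

Lemma lg_leIl x y : x ∧ y <= x.
Proof. by have := lexx (x ∧ y); rewrite lg_lexI => /andP[]. Qed.

Lemma lg_leIr x y : x ∧ y <= y.
Proof. by have := lexx (x ∧ y); rewrite lg_lexI => /andP[]. Qed.

Lemma lg_leUl x y : x <= x ∨ y.
Proof. by have := lexx (x ∨ y); rewrite lg_leUx => /andP[]. Qed.

Lemma lg_leUr x y : y <= x ∨ y.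
Proof. by have := lexx (x ∨ y); rewrite lg_leUx => /andP[]. Qed.

Lemma lg_meetC x y : x ∧ y = y ∧ x.
Proof. by apply: lg_eq_le => z; rewrite !lg_lexI andbC. Qed.

Lemma lg_joinC x y : x ∨ y = y ∨ x.
Proof. by apply: lg_eq_ge => z; rewrite !lg_leUx andbC. Qed.

Lemma lg_meetA x y z : x ∧ (y ∧ z) = x ∧ y ∧ z.
Proof. by apply: lg_eq_le => t; rewrite !lg_lexI andbA. Qed.

Lemma lg_meet_l x y : x <= y -> x ∧ y = x.
Proof. by move=> xy; apply/le_anti; rewrite lg_leIl lg_lexI lexx xy. Qed.

Lemma lg_meet_r x y : y <= x -> x ∧ y = y.
Proof. by rewrite lg_meetC; exact: lg_meet_l. Qed.

Lemma lg_join_l x y : y <= x -> x ∨ y = x.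
Proof. by move=> xy; apply/le_anti; rewrite lg_leUl lg_leUx lexx xy. Qed.

Lemma lg_join_r x y : x <= y -> x ∨ y = y.
Proof. by rewrite lg_joinC; exact: lg_join_l. Qed.

Lemma lg_meetDr x y z : (x ∧ y) + z = (x + z) ∧ (y + z).
Proof. by apply: lg_eq_le => t; rewrite lg_lexI -!lg_lerBl lg_lexI. Qed.

Lemma lg_joinDr x y z : (x ∨ y) + z = (x + z) ∨ (y + z).
Proof. by apply: lg_eq_ge => t; rewrite lg_leUx -!lg_lerBr lg_leUx. Qed.

Lemma lg_oppI x y : - (x ∧ y) = (- x) ∨ (- y).
Proof.
by apply: lg_eq_ge => z; rewrite lg_leUx -[z]opprK !lg_lerN2 lg_lexI.
Qed.

Lemma lg_mulrn_ge0 x n : 0 <= x -> 0 <= x *+ n.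
Proof.
by move=> x0; elim: n => // n IH; rewrite mulrS (le_trans x0) // lg_lerDl.
Qed.

Lemma lg_meet_subadd x y z : 0 <= x -> 0 <= y -> 0 <= z ->
  x ∧ (y + z) <= (x ∧ y) + (x ∧ z).
Proof.
move=> x0 y0 z0; set t := x ∧ (y + z).
have tx : t <= x by apply: lg_leIl.
have lexD (a b : G) : 0 <= b -> a <= a + b.
  by rewrite lg_lerDl.
rewrite lg_meetDr ![_ + (x ∧ z)]addrC !lg_meetDr !lg_lexI.
apply/andP; split; apply/andP; split.
- by apply: (le_trans tx); apply: lexD.
- by apply: (le_trans tx); rewrite addrC; apply: lexD.
- by apply: (le_trans tx); apply: lexD.
- by rewrite [z + y]addrC; apply: lg_leIr.
Qed.

Lemma lg_disjoint_mulrn x y n : 0 <= x -> 0 <= y -> x ∧ y = 0 ->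
  x ∧ (y *+ n) = 0.
Proof.
move=> x0 y0 xy0; elim: n => [|n IH]; first by rewrite mulr0n lg_meet_r.
apply/le_anti; rewrite lg_lexI x0 lg_mulrn_ge0 // !andbT mulrS.
apply: (le_trans (lg_meet_subadd x0 y0 (lg_mulrn_ge0 n y0))).
by rewrite xy0 IH addr0.
Qed.

Lemma lg_pos_neg_disjoint x : (x ∨ 0) ∧ ((- x) ∨ 0) = 0.
Proof.
have -> : (- x) ∨ 0 = - x + (x ∨ 0).
  by rewrite [RHS]addrC lg_joinDr subrr add0r lg_joinC.
rewrite -[X in X ∧ _]add0r -lg_meetDr -[X in X + _ = _]opprK lg_oppI opprK oppr0.
by rewrite lg_joinC addNr.
Qed.

End LGroupTheory.

Definition gamma (G : uaGroup) : Type := {x : G | 0 <= x <= uag_unit G}.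

Definition gamma_elt (G : uaGroup) (x : G) (hx : 0 <= x <= uag_unit G) :
  gamma G := exist (fun x : G => is_true (0 <= x <= uag_unit G)) x hx.

Section Gamma.
Variable G : uaGroup.
Local Notation u := (uag_unit G).
Implicit Types x y z : gamma G.

Let u_ge0 : 0 <= u. Proof. by case: (uag_strong_unit G). Qed.

Lemma gamma_eq x y : val x = val y -> x = y. Proof. exact: val_inj. Qed.

Lemma gamma_ge0 x : 0 <= val x. Proof. by case/andP: (valP x). Qed.

Lemma gamma_leu x : val x <= u. Proof. by case/andP: (valP x). Qed.

Fact gamma_zero_subproof : 0 <= (0 : G) <= u.
Proof. by rewrite lexx u_ge0. Qed.

Fact gamma_plus_subproof x y : 0 <= (val x + val y) ∧ u <= u.
Proof.
rewrite lg_leIr lg_lexI u_ge0 !andbT (le_trans (gamma_ge0 x)) //.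
by rewrite lg_lerDl gamma_ge0.
Qed.

Fact gamma_neg_subproof x : 0 <= u - val x <= u.
Proof.
by rewrite lg_subr_ge0 gamma_leu lg_lerBl lg_lerDl gamma_ge0.
Qed.

Definition gamma_zero : gamma G := gamma_elt gamma_zero_subproof.
Definition gamma_plus x y : gamma G := gamma_elt (gamma_plus_subproof x y).
Definition gamma_neg x : gamma G := gamma_elt (gamma_neg_subproof x).

Fact gamma_plusA x y z :
  gamma_plus x (gamma_plus y z) = gamma_plus (gamma_plus x y) z.
Proof.
have h (a b c : G) : 0 <= c -> ((a + b) ∧ u + c) ∧ u = (a + b + c) ∧ u.
  move=> c0; rewrite lg_meetDr -lg_meetA [(u + c) ∧ u]lg_meet_r //.
  by rewrite lg_lerDl.
apply: gamma_eq => /=; rewrite [val x + _]addrC !h ?gamma_ge0 //.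
by rewrite [_ + val x]addrC addrA.
Qed.

Fact gamma_plusC x y : gamma_plus x y = gamma_plus y x.
Proof. by apply: gamma_eq => /=; rewrite addrC. Qed.

Fact gamma_plus0 x : gamma_plus x gamma_zero = x.
Proof. by apply: gamma_eq => /=; rewrite addr0 lg_meet_l // gamma_leu. Qed.

Fact gamma_negK x : gamma_neg (gamma_neg x) = x.
Proof. by apply: gamma_eq => /=; rewrite opprB addrC subrK. Qed.

Fact gamma_plus1 x : gamma_plus (gamma_neg gamma_zero) x = gamma_neg gamma_zero.
Proof.
apply: gamma_eq => /=; rewrite subr0 lg_meet_r //.
by rewrite lg_lerDl gamma_ge0.
Qed.

Lemma gamma_plusE x y : val (gamma_plus x y) = (val x + val y) ∧ u.
Proof. by []. Qed.

Lemma gamma_subE x y :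
  val (gamma_neg (gamma_plus (gamma_neg x) y)) = (val x - val y) ∨ 0.
Proof.
rewrite /= addrC lg_oppI lg_joinDr addNr opprD opprB addrAC [val x - u]addrC.
by rewrite -[- u + _]addrC subrK.
Qed.

Fact gamma_luk x y :
  gamma_plus (gamma_neg (gamma_plus (gamma_neg x) y)) y =
  gamma_plus (gamma_neg (gamma_plus (gamma_neg y) x)) x.
Proof.
have h a b : val (gamma_plus (gamma_neg (gamma_plus (gamma_neg a) b)) b) =
    (val a ∨ val b) ∧ u.
  by rewrite gamma_plusE gamma_subE lg_joinDr subrK add0r.
by apply: gamma_eq; rewrite !h lg_joinC.
Qed.

HB.instance Definition _ := isMVAlgebra.Build (gamma G)
  gamma_plusA gamma_plusC gamma_plus0 gamma_negK gamma_plus1 gamma_luk.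

End Gamma.

Section MaximalIdeals.
Variable A : mvAlgType.
Implicit Types I J : set A.

Lemma mvneg0_ub (a : A) : mvle a (mvneg mvzero).
Proof. by rewrite /mvle /mvtimes mvnegK mvplusC mvplus1 mvnegK. Qed.

Lemma mv_ideal_proper I :
  mv_ideal I -> (I <> setT) <-> ~ I (mvneg mvzero).
Proof.
case=> _ Idown _; split=> [IT I1|I1 IT]; last by apply: I1; rewrite IT.
by apply: IT; apply/seteqP; split=> // a _; apply: Idown I1; apply: mvneg0_ub.
Qed.

Lemma mv_maximal_ext I : mv_ideal I -> I <> setT ->
  exists M, mv_maximal M /\ I `<=` M.
Proof.
move=> idI propI; have [[i Ii] _ _] := idI.
pose P J := J = set0 \/ [/\ mv_ideal J, ~ J (mvneg mvzero) & I `<=` J].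
have [F FP Ftot|M [PM maxM]] := @Zorn_bigcup A P.
  have [[J FJ [a Ja]]|F0] := pselect (exists2 J, F J & J !=set0); last first.
    left; apply/seteqP; split=> // x [J FJ Jx]; apply: F0.
    by exists J => //; exists x.
  have FI K : F K -> K !=set0 -> [/\ mv_ideal K, ~ K (mvneg mvzero) & I `<=` K].
    by move=> /FP[-> []|].
  right; split; last 2 first.
  - by move=> [K FK K1]; have [|_ + _] := FI K FK; [exists (mvneg mvzero)|apply].
  - by move=> x Ix; exists J => //; have [|_ _] := FI J FJ; [exists a|apply].
  split; first by exists a; exists J.
  - move=> x y xy [K FK Ky]; exists K => //.
    by have [|[_ Kd _] _ _] := FI K FK; [exists y|exact: Kd Ky].
  - move=> x y [K FK Kx] [L FL Ly].
    have [KL|LK] := Ftot K L FK FL.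
    + exists L => //; have [|[_ _ LD] _ _] := FI L FL; first by exists y.
      by apply: LD => //; apply: KL.
    + exists K => //; have [|[_ _ KD] _ _] := FI K FK; first by exists x.
      by apply: KD => //; apply: LK.
have PI : P I by right; split=> //; apply/mv_ideal_proper.
case: PM => [M0|[idM M1 IM]].
  exfalso; apply: (maxM I _ PI); rewrite M0 properEneq; split=> //.
  by apply/eqP => I0; rewrite -I0 in Ii.
exists M; split=> //; split=> //; first exact/mv_ideal_proper.
move=> J idJ /(mv_ideal_proper idJ) J1 MJ; apply: contrapT => JM.
apply: (maxM J); last by right; split=> //; apply: subset_trans MJ.
by rewrite properEneq; split=> //; apply/eqP => MJe; apply: JM.
Qed.

End MaximalIdeals.

Section GammaSemisimple.
Variable G : uaGroup.
Local Notation u := (uag_unit G).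
Implicit Types x y : gamma G.

Lemma gamma_timesNE x y : val (x ⊙ mvneg y)%MV = (val x - val y) ∨ 0.
Proof. by rewrite -gamma_subE /mvtimes mvnegK. Qed.

Lemma gamma_leE x y : mvle x y <-> val x <= val y.
Proof.
rewrite /mvle; split=> [/(congr1 val)|xy]; last apply: gamma_eq;
  rewrite gamma_timesNE.
- move=> h; have : val x - val y <= 0 by rewrite -[X in _ <= X]h lg_leUl.
  by rewrite lg_lerBl add0r.
- by rewrite lg_join_r // lg_lerBl add0r.
Qed.

Theorem gamma_semisimple : mv_semisimple (gamma G).
Proof.
have [u0 su] := uag_strong_unit G.
apply/seteqP; split=> [a aM|_ -> I [[[b Ib] Id _] _ _]]; last first.
  by apply: Id Ib; apply/gamma_leE/gamma_ge0.
apply: contrapT => a0.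
have [n nau] : exists n, ~ val a *+ n <= u.
  apply: contrapT => h; apply: a0; apply: gamma_eq => /=.
  apply/le_anti; rewrite gamma_ge0 andbT; apply: (@uag_archimedean G _ u) => n.
  by apply: contrapT => /negP h'; apply: h; exists n; apply/negP.
have na0 : 0 <= val a *+ n by apply/lg_mulrn_ge0/gamma_ge0.
(* d is the complement (u - na) ∨ 0 of na ∧ u *)
pose mul k : gamma G := iter k (mvplus a) mvzero.
have mulE k : val (mul k) = (val a *+ k) ∧ u.
  elim: k => [|k IH]; first by rewrite mulr0n lg_meet_l.
  rewrite [LHS]/= -/(mul k) IH addrC lg_meetDr -lg_meetA mulrSr; congr (_ ∧ _).
  by apply: lg_meet_r; rewrite lg_lerDl gamma_ge0.
pose d := mvneg (mul n).
have dE : val d = (u - val a *+ n) ∨ 0.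
  by rewrite [LHS]/= mulE addrC lg_oppI lg_joinDr addNr addrC.
have d0 := gamma_ge0 d.
pose I := [set x : gamma G | exists k, val x <= val d *+ k].
have idI : mv_ideal I.
  split; first by exists d; exists 1%N; rewrite mulr1n.
  - by move=> x y /gamma_leE xy [k yk]; exists k; exact: le_trans yk.
  - move=> x y [k xk] [l yl]; exists (k + l)%N; rewrite mulrnDr.
    by apply: (le_trans (lg_leIl _ _)); apply: lg_leD.
have propI : I <> setT.
  move=> IT; have [k] : I (mvneg mvzero) by rewrite IT.
  rewrite [val _]/= subr0 => uk.
  pose w := (val a *+ n - u) ∨ 0.
  have w0 : 0 <= w by exact: lg_leUr.
  have wd : w ∧ val d = 0.
    by rewrite dE -[u - _]opprB; exact: lg_pos_neg_disjoint.
  have wu : w ∧ u = 0.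
    apply/le_anti; rewrite lg_lexI w0 u0 /= andbT.
    rewrite -(lg_disjoint_mulrn k w0 d0 wd) lg_lexI lg_leIl.
    exact: le_trans (lg_leIr _ _) uk.
  have [m wm] := su w.
  have {}w0 : w = 0 by rewrite -[LHS](lg_meet_l wm) lg_disjoint_mulrn.
  have : val a *+ n - u <= 0 by rewrite -[X in _ <= X]w0 lg_leUl.
  by rewrite lg_lerBl add0r.
have [M [maxM IM]] := mv_maximal_ext idI propI.
have [idM propM _] := maxM; have [_ _ MD] := idM.
have Md : M d by apply: IM; exists 1%N; rewrite mulr1n.
have Mmul k : M (mul k).
  elim: k => [|k IH]; last by apply: MD => //; apply: aM.
  by case: idM => -[b Mb] Mdown _; apply: Mdown Mb; apply/gamma_leE/gamma_ge0.
move/(mv_ideal_proper idM): propM; apply.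
suff -> : mvneg mvzero = (mul n ⊕ d)%MV by apply: MD.
by apply: gamma_eq; rewrite /= subr0 addrC subrK lg_meet_l.
Qed.

Definition Gamma_obj : ssMV := SsMV gamma_semisimple.

End GammaSemisimple.

Section GammaMorphisms.
Variables (G H : uaGroup) (f : uaGroupHom G H).

Lemma uaghom0 : f 0 = 0.
Proof.
have [fD _ _] := uaghomP f.
by apply: (addIr (f 0)); rewrite -fD !add0r.
Qed.

Lemma uaghomN x : f (- x) = - f x.
Proof.
have [fD _ _] := uaghomP f.
by apply: (addIr (f x)); rewrite -fD !addNr uaghom0.
Qed.

Lemma uaghom_le x y : x <= y -> f x <= f y.
Proof. by have [_ fI _] := uaghomP f; move/lg_meet_l <-; rewrite fI lg_leIr. Qed.

Fact gamma_map_subproof (x : gamma G) : 0 <= f (val x) <= uag_unit H.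
Proof.
by rewrite -uaghom0 -(uaghom_unit f) !uaghom_le ?gamma_ge0 ?gamma_leu.
Qed.

Definition gamma_map (x : gamma G) : gamma H := gamma_elt (gamma_map_subproof x).

Fact gamma_map_hom : mv_hom gamma_map.
Proof.
have [fD fI _] := uaghomP f.
split=> [|x y|x]; apply: gamma_eq => /=; first exact: uaghom0.
- by rewrite fI fD uaghom_unit.
- by rewrite fD uaghomN uaghom_unit.
Qed.

Definition Gamma_mor : mvHom (gamma G) (gamma H) := MVHom gamma_map_hom.

End GammaMorphisms.

Fact Gamma_id (G : uaGroup) : Gamma_mor (uagid G) = mvid (gamma G).
Proof. by apply: mvHom_eq => x; apply: gamma_eq. Qed.

Fact Gamma_comp (G H K : uaGroup) (g : uaGroupHom H K) (f : uaGroupHom G H) :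
  Gamma_mor (uagcomp g f) = mvcomp (Gamma_mor g) (Gamma_mor f).
Proof. by apply: mvHom_eq => x; apply: gamma_eq. Qed.

Definition Gamma : functor AGua MVs :=
  @Functor AGua MVs Gamma_obj Gamma_mor Gamma_id Gamma_comp.

Section GammaRiesz.
Variables (R : realType) (L : uaRiesz R).
Let G := uaGroup_of_uaRiesz L.

Definition gammaR : Type := gamma G.

HB.instance Definition _ := MVAlgebra.on gammaR.

Implicit Types (r q : {i01 R}) (x y : L).

Lemma rs_scale_le (a : R) x y : 0 <= a -> x <= y -> a *: x <= a *: y.
Proof.
move=> a0 xy; rewrite -lg_subr_ge0 -scalerBr rs_scale_ge0 //.
by rewrite lg_subr_ge0.
Qed.

Lemma rs_scale_join (a : R) x y : 0 <= a -> a *: (x ∨ y) = (a *: x) ∨ (a *: y).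
Proof.
rewrite le_eqVlt => /predU1P[<-|a0]; first by rewrite !scale0r lg_join_l.
have a0' := ltW a0.
apply/le_anti; rewrite lg_leUx !rs_scale_le ?lg_leUl ?lg_leUr // !andbT.
rewrite -[X in _ <= X]scale1r -(divff (lt0r_neq0 a0)) -scalerA.
apply: rs_scale_le => //; rewrite lg_leUx; apply/andP; split.
- rewrite -[X in X <= _]scale1r -(mulVf (lt0r_neq0 a0)) -scalerA.
  by apply: rs_scale_le; rewrite ?invr_ge0 ?lg_leUl.
- rewrite -[X in X <= _]scale1r -(mulVf (lt0r_neq0 a0)) -scalerA.
  by apply: rs_scale_le; rewrite ?invr_ge0 ?lg_leUr.
Qed.

Fact gammaR_scale_subproof r (x : gammaR) : 0 <= r%:num *: (val x : L) <= uar_unit L.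
Proof.
have x0 : 0 <= (val x : L) := gamma_ge0 x.
rewrite rs_scale_ge0 //=; apply: le_trans (gamma_leu x).
by rewrite -lg_subr_ge0 -[X in X - _]scale1r -scalerBl rs_scale_ge0.
Qed.

Definition gammaR_scale r (x : gammaR) : gammaR :=
  @gamma_elt G (r%:num *: (val x : L)) (gammaR_scale_subproof r x).

Fact gammaR_scale_sub r (a b : gammaR) :
  gammaR_scale r (a ⊙ mvneg b)%MV =
  (gammaR_scale r a ⊙ mvneg (gammaR_scale r b))%MV.
Proof.
apply: gamma_eq; rewrite gamma_timesNE.
rewrite [LHS]/=.
rewrite -[X in _ *: X]/(val (a ⊙ mvneg b)%MV) gamma_timesNE.
by rewrite (rs_scale_join _ 0) // scalerBr scaler0.
Qed.

Fact gammaR_scale_subl r q (a : gammaR) :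
  gammaR_scale (Num.max (r%:num - q%:num) 0)%:i01 a =
  (gammaR_scale r a ⊙ mvneg (gammaR_scale q a))%MV.
Proof.
apply: gamma_eq; rewrite gamma_timesNE /=.
have a0 : 0 <= (val a : L) := gamma_ge0 a.
rewrite -scalerBl; case: (lerP (r%:num - q%:num) 0) => h.
- rewrite scale0r [RHS]lg_join_r // -lg_lerN2 oppr0 -scaleNr rs_scale_ge0 //.
  by rewrite oppr_ge0.
- by rewrite [RHS]lg_join_l // rs_scale_ge0 // ltW.
Qed.

Fact gammaR_scaleA r q (a : gammaR) :
  gammaR_scale (r%:num * q%:num)%:i01 a = gammaR_scale r (gammaR_scale q a).
Proof. by apply: gamma_eq; rewrite /= scalerA. Qed.

Fact gammaR_scale1 (a : gammaR) : gammaR_scale 1%:i01 a = a.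
Proof. by apply: gamma_eq; rewrite /= scale1r. Qed.

HB.instance Definition _ := MVAlgebra_isRieszMV.Build R gammaR
  gammaR_scale_sub gammaR_scale_subl gammaR_scaleA gammaR_scale1.

Fact gammaR_semisimple : mv_semisimple gammaR.
Proof. exact: gamma_semisimple. Qed.

Definition GammaR_obj : ssRieszMV R := SsRieszMV gammaR_semisimple.

End GammaRiesz.

Section GammaRFunctor.
Variable R : realType.

Definition GammaR_mor (L M : uaRiesz R) (f : uaRieszHom L M) :
  mvHom (gammaR L) (gammaR M) := Gamma_mor (uaGroupHom_of_uaRieszHom f).

Fact GammaR_id (L : uaRiesz R) : GammaR_mor (uarid L) = mvid (gammaR L).
Proof. by apply: mvHom_eq => x; apply: gamma_eq. Qed.

Fact GammaR_comp (L M N : uaRiesz R) (g : uaRieszHom M N)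
    (f : uaRieszHom L M) :
  GammaR_mor (uarcomp g f) = mvcomp (GammaR_mor g) (GammaR_mor f).
Proof. by apply: mvHom_eq => x; apply: gamma_eq. Qed.

Definition GammaR : functor (RSua R) (RMVs R) :=
  @Functor (RSua R) (RMVs R) (@GammaR_obj R) GammaR_mor GammaR_id GammaR_comp.

End GammaRFunctor.

Definition divisible (G : lgroupType) : Prop :=
  forall (x : G) n, (0 < n)%N -> exists y : G, y *+ n = x.

(* [D] is, via [d], the divisible hull {g/n} of [G]. *)
Definition divisible_hull (G D : lgroupType) (d : G -> D) : Prop :=
  [/\ lgroup_hom d, injective d, divisible D
    & forall x : D, exists n g, (0 < n)%N /\ x *+ n = d g].

Definition conditionally_complete (C : lgroupType) : Prop :=
  forall S : set C, S !=set0 -> has_ubound S -> supremums S !=set0.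

(* Every element being a supremum of elements of [D] implies, by negation,    *)
(* that every element is an infimum of elements of [D].                       *)
Definition lg_completion (D C : lgroupType) (c : D -> C) : Prop :=
  [/\ lgroup_hom c, injective c, conditionally_complete C
    & forall x : C, exists S : set D, supremums (c @` S) x].

Definition riesz_subspace (R : realType) (C : rieszType R) (S : set C) : Prop :=
  [/\ S 0, forall x y, S x -> S y -> S (x + y),
      forall (a : R) x, S x -> S (a *: x),
      forall x y, S x -> S y -> S (x ∧ y)
    & forall x y, S x -> S y -> S (x ∨ y)].

(* [L] is, via [iota], the hull of [G]: [e] identifies [L] with the Riesz     *)
(* subspace generated by the divisible hull [D] in its completion [C].        *)
Definition group_hull (R : realType) (G : lgroupType) (L : rieszType R)
    (iota : G -> L) : Prop :=
  exists (D : lgroupType) (d : G -> D) (C : rieszType R) (c : D -> C)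
      (e : L -> C),
    [/\ divisible_hull d, lg_completion c, riesz_hom e /\ injective e,
        range e = smallest (@riesz_subspace R C) (range c)
      & forall g, e (iota g) = c (d g)].

(* The hull is determined up to isomorphism only, hence a predicate on        *)
(* functors. [RG h] extends [h]; it is the only such morphism, as [RG G] is   *)
(* generated by [G] as a Riesz space (G_d being spanned by [G] over Q).       *)
Definition group_hull_functor (R : realType) (RG : functor AGua (RSua R)) :
    Prop :=
  exists iota : forall G : uaGroup,
      uaGroupHom G (uaGroup_of_uaRiesz (RG G)),
    (forall G : uaGroup, group_hull (L := RG G : uaRiesz R) (iota G)) /\
    (forall (G H : uaGroup) (h : uaGroupHom G H) (x : G),
       (fmap RG h : uaRieszHom _ _) (iota G x) = iota H (h x)).

(* [B] is, via [j], the divisible hull of [A]: up to isomorphism, [j] is the  *)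
(* inclusion of [gamma G] into [gamma D] with [D] the divisible hull of [G].  *)
Definition mv_divisible_hull (A B : mvAlgType) (j : A -> B) : Prop :=
  exists (G D : uaGroup) (d : uaGroupHom G D)
      (phi : gamma G -> A) (psi : gamma D -> B),
    [/\ divisible_hull d, mv_iso phi, mv_iso psi
      & forall x, j (phi x) = psi (Gamma_mor d x)].

Definition mv_is_sup (A : mvAlgType) (S : set A) (s : A) : Prop :=
  (forall a, S a -> mvle a s) /\
  (forall t, (forall a, S a -> mvle a t) -> mvle s t).

Definition mv_is_inf (A : mvAlgType) (S : set A) (s : A) : Prop :=
  (forall a, S a -> mvle s a) /\
  (forall t, (forall a, S a -> mvle t a) -> mvle t s).

Definition mv_complete (A : mvAlgType) : Prop :=
  forall S : set A, (exists s, mv_is_sup S s) /\ (exists i, mv_is_inf S i).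

Definition mv_completion (B M : mvAlgType) (m : B -> M) : Prop :=
  [/\ mv_hom m, injective m, mv_complete M
    & forall x : M, exists S : set B, mv_is_sup (m @` S) x].

Definition rmv_subalgebra (R : realType) (V : rieszMVType R) (S : set V) :
    Prop :=
  [/\ S mvzero, forall a b, S a -> S b -> S (a ⊕ b)%MV,
      forall a, S a -> S (mvneg a)
    & forall (r : {i01 R}) a, S a -> S (mvscale r a)].

(* [V] is, via [iota], the hull of [A]: [e] identifies [V] with the Riesz     *)
(* MV-subalgebra generated by [A] in the completion [M] of its divisible      *)
(* hull [B].                                                                  *)
Definition mv_hull (R : realType) (A : mvAlgType) (V : rieszMVType R)
    (iota : A -> V) : Prop :=
  exists (B : mvAlgType) (j : A -> B) (M : rieszMVType R) (m : B -> M)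
      (e : V -> M),
    [/\ mv_divisible_hull j, mv_completion m,
        [/\ mv_hom e, injective e
          & forall r : {i01 R}, {morph e : a / mvscale r a}],
        range e = smallest (@rmv_subalgebra R M) (range (m \o j))
      & forall a, e (iota a) = m (j a)].

(* As for groups, [RA h] is the only homomorphism with this property.         *)
Definition mv_hull_functor (R : realType) (RA : functor MVs (RMVs R)) : Prop :=
  exists iota : forall A : ssMV, mvHom A (RA A : ssRieszMV R),
    (forall A : ssMV, mv_hull (V := RA A : ssRieszMV R) (iota A)) /\
    (forall (A B : ssMV) (h : mvHom A B) (a : A),
       (fmap RA (X := A) (Y := B) h : mvHom _ _) (iota A a) = iota B (h a)).

(* Main.v *)
(* Both composites send (G, u) to a semisimple Riesz MV-algebra generated by an
   embedded copy of A = Γ(G, u), and such an extension of A is unique up to a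
   unique isomorphism over A.  For the uniqueness, let V and W be two such
   extensions and P the Riesz MV-subalgebra of V × W generated by the diagonal
   image of A; it must be shown that (0, w) ∈ P forces w = 0.  If w ≠ 0, then
   some [0, 1]-valued homomorphism f of W has f w > 0.  By induction on P, there
   is b ∈ A with f b > 0 such that every [0, 1]-valued homomorphism g of V with
   g b > 0 takes at 0 a value close to f w.  As b ≠ 0 and V is semisimple, such a
   g exists, which is absurd. *)

From mathcomp Require Import all_boot all_order all_algebra.
From mathcomp Require Import boolp classical_sets reals interval_inference.
From mathcomp Require Import lra.
Require Import Defs.

Set Implicit Arguments.
Unset Strict Implicit.
Unset Printing Implicit Defensive.

Import Order.TTheory GRing.Theory Num.Theory.

Local Open Scope classical_set_scope.
Local Open Scope ring_scope.
Local Open Scope mv_scope.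

(** * Arithmetic and order of MV-algebras *)

Section MVTheory.
Variable A : mvAlgType.
Implicit Types a b c d : A.
Local Notation "0" := (@mvzero A).
Local Notation "1" := (mvneg (@mvzero A)).

Lemma mvplus0l a : 0 ⊕ a = a.
Proof. by rewrite mvplusC mvplus0. Qed.

Lemma mvplusCA a b c : a ⊕ (b ⊕ c) = b ⊕ (a ⊕ c).
Proof. by rewrite !mvplusA [a ⊕ b]mvplusC. Qed.

Lemma mvplusACA a b c d : (a ⊕ b) ⊕ (c ⊕ d) = (a ⊕ c) ⊕ (b ⊕ d).
Proof. by rewrite -!mvplusA [b ⊕ (c ⊕ d)]mvplusCA. Qed.

Lemma mvtimesC a b : a ⊙ b = b ⊙ a.
Proof. by rewrite /mvtimes mvplusC. Qed.

Lemma mvtimesA a b c : a ⊙ (b ⊙ c) = a ⊙ b ⊙ c.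
Proof. by rewrite /mvtimes !mvnegK mvplusA. Qed.

Lemma mvtimes1 a : a ⊙ 1 = a.
Proof. by rewrite /mvtimes mvnegK mvplus0 mvnegK. Qed.

Lemma mvplusN a : mvneg a ⊕ a = 1.
Proof. by have := mv_luk a 1; rewrite mvplusC mvplus1 mvnegK mvplus0l. Qed.

Lemma mvleP a b : mvle a b <-> mvneg a ⊕ b = 1.
Proof.
rewrite /mvle /mvtimes mvnegK; split=> [h|->]; last by rewrite mvnegK.
by rewrite -[LHS]mvnegK h.
Qed.

Lemma mvle_refl a : mvle a a.
Proof. exact/mvleP/mvplusN. Qed.

Lemma mvle_plusr a c : mvle a (a ⊕ c).
Proof. by apply/mvleP; rewrite mvplusA mvplusN mvplus1. Qed.

Lemma mv0le a : mvle 0 a.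
Proof. by rewrite -[a]mvplus0l; exact: mvle_plusr. Qed.

Lemma mvle_subK a b : mvle a b -> a ⊕ (b ⊙ mvneg a) = b.
Proof.
move/mvleP => ab; have := mv_luk a b.
by rewrite ab mvnegK mvplus0l mvplusC /mvtimes mvnegK => <-.
Qed.

Lemma mvle_trans b a c : mvle a b -> mvle b c -> mvle a c.
Proof.
move=> /mvle_subK <- /mvle_subK <-; rewrite -mvplusA; exact: mvle_plusr.
Qed.

Lemma mvle_anti a b : mvle a b -> mvle b a -> a = b.
Proof.
move=> /mvleP ab /mvleP ba; have := mv_luk a b.
by rewrite ab ba mvnegK !mvplus0l.
Qed.

Lemma mvle_plus a b c d : mvle a b -> mvle c d -> mvle (a ⊕ c) (b ⊕ d).
Proof.
move=> /mvle_subK <- /mvle_subK <-; rewrite mvplusACA; exact: mvle_plusr.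
Qed.

(** Truncated subtraction of [b] is left adjoint to adding [b]; later inequalities are mostly proved
    by moving terms across with this equivalence. *)
Lemma mvle_subl a b c : mvle (a ⊙ mvneg b) c <-> mvle a (b ⊕ c).
Proof. by rewrite !mvleP /mvtimes !mvnegK mvplusA. Qed.

Lemma mvle_timesl a b : mvle (a ⊙ b) a.
Proof.
rewrite -[b]mvnegK; apply/mvle_subl; rewrite mvplusC; exact: mvle_plusr.
Qed.

Lemma mvle_timesr a b : mvle (a ⊙ b) b.
Proof. rewrite mvtimesC; exact: mvle_timesl. Qed.

Lemma mvle_neg a b : mvle a b -> mvle (mvneg b) (mvneg a).
Proof. by rewrite /mvle mvnegK mvtimesC. Qed.

Lemma mvle_addsub a b : mvle a (b ⊕ (a ⊙ mvneg b)).
Proof. by apply/mvle_subl; exact: mvle_refl. Qed.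

(** The lattice infimum; the asymmetric formula is symmetric by the Łukasiewicz axiom [mv_luk]. *)
Definition mvmeet a b := a ⊙ (mvneg a ⊕ b).

Lemma mvmeetC a b : mvmeet a b = mvmeet b a.
Proof.
rewrite /mvmeet /mvtimes; congr mvneg.
have := mv_luk (mvneg a) (mvneg b); rewrite !mvnegK => h.
by rewrite mvplusC [mvneg a ⊕ b]mvplusC -h [RHS]mvplusC [mvneg b ⊕ a]mvplusC.
Qed.

Lemma mvmeet_lel a b : mvle (mvmeet a b) a.
Proof. exact: mvle_timesl. Qed.

Lemma mvmeet_ler a b : mvle (mvmeet a b) b.
Proof. rewrite mvmeetC; exact: mvle_timesl. Qed.

Lemma mvle_times a b c d : mvle a b -> mvle c d -> mvle (a ⊙ c) (b ⊙ d).
Proof. by move=> ab cd; apply/mvle_neg/mvle_plus; apply/mvle_neg. Qed.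

Lemma mvle_meet c a b : mvle c a -> mvle c b -> mvle c (mvmeet a b).
Proof.
move=> /mvle_subK ca cb; rewrite mvmeetC.
(* As [c] lies below [b], it can be rewritten as its meet with [b], which reduces the goal to
   monotonicity in the other argument. *)
have -> : c = mvmeet b c.
  rewrite mvmeetC /mvmeet; move/mvleP: cb => ->.
  by rewrite mvtimes1.
apply: mvle_times (mvle_refl _) _; apply: mvle_plus (mvle_refl _) _.
by rewrite -ca; exact: mvle_plusr.
Qed.

Lemma mvle0 a : mvle a 0 -> a = 0.
Proof. by move=> a0; apply: mvle_anti a0 (mv0le a). Qed.

Lemma mv_prelinear a b : mvmeet (a ⊙ mvneg b) (b ⊙ mvneg a) = 0.
Proof.
(* With q = b ⊙ ¬a and z = a ⊙ (¬b ⊕ a), commutativity of ∧ turns the left side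
   into ¬a ⊙ (b ∧ z), and z <= a. *)
set q := b ⊙ mvneg a.
rewrite {1}/mvmeet.
have -> : mvneg (a ⊙ mvneg b) = mvneg a ⊕ b by rewrite /mvtimes !mvnegK.
rewrite -mvplusA mvplusCA -mvtimesA.
rewrite -[X in X ⊕ _]mvnegK -/(mvmeet (mvneg b) (mvneg a ⊕ q)) mvmeetC /mvmeet.
rewrite mvtimesA -/(mvmeet a q) mvmeetC /mvmeet.
have -> : mvneg (mvneg a ⊕ q) = a ⊙ mvneg q by rewrite /mvtimes !mvnegK.
rewrite -mvtimesA {1}/q -mvtimesA.
have qN : mvneg q = mvneg b ⊕ a by rewrite /q /mvtimes !mvnegK.
rewrite qN.
set z := a ⊙ (mvneg b ⊕ a).
apply: mvle0; apply: (@mvle_trans (a ⊙ mvneg a)); last first.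
  by apply/mvle_subl/mvle_plusr.
rewrite [mvneg a ⊙ _]mvtimesC mvtimesA; apply: mvle_times (mvle_refl _).
apply: (@mvle_trans (mvmeet b z)).
  rewrite /mvmeet; apply: mvle_times (mvle_refl _) _.
  apply: (mvle_trans (mvle_timesr _ _)).
  by rewrite mvplusC; apply: mvle_refl.
by apply: (mvle_trans (mvmeet_ler _ _)); apply: mvle_timesl.
Qed.

Definition mvmul n a : A := iter n (mvplus a) 0.

Lemma mvle_meet_plus a b c :
  mvle (mvmeet a (b ⊕ c)) (mvmeet a b ⊕ mvmeet a c).
Proof.
set t := mvmeet a (b ⊕ c).
have ta : mvle t a by exact: mvmeet_lel.
apply/mvle_subl/mvle_meet; first by apply: mvle_trans ta; apply: mvle_timesl.
apply/mvle_subl; rewrite mvplusC; apply/mvle_subl/mvle_meet.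
  by apply: mvle_trans ta; apply: mvle_timesl.
by apply/mvle_subl; rewrite mvplusC; apply: mvmeet_ler.
Qed.

Lemma mvmeet_mul n a b : mvmeet a b = 0 -> mvmeet a (mvmul n b) = 0.
Proof.
move=> ab; elim: n => [|n IH]; first by apply/mvle0/mvmeet_ler.
apply/mvle0; apply: (mvle_trans (mvle_meet_plus _ _ _)).
by rewrite ab IH mvplus0; apply: mvle_refl.
Qed.

End MVTheory.

(** * Maximal ideals and the order of their quotients *)

Section MaximalQuotient.
Variables (A : mvAlgType) (I : set A).
Hypothesis maxI : mv_maximal I.
Implicit Types a b c d : A.

(** The order of the quotient by [I], read on representatives so that no quotient type has to be
    formed. *)
Definition mvle_mod a b := I (a ⊙ mvneg b).

Let idI : mv_ideal I. Proof. by case: maxI. Qed.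

Lemma mv_ideal0 : I mvzero.
Proof. by have [[a Ia] Id _] := idI; apply: Id Ia; apply: mv0le. Qed.

Lemma mvle_modW a b : mvle a b -> mvle_mod a b.
Proof. by rewrite /mvle_mod /mvle => ->; exact: mv_ideal0. Qed.

Lemma mvle_mod_trans b a c : mvle_mod a b -> mvle_mod b c -> mvle_mod a c.
Proof.
have [_ Id ID] := idI => ab bc; apply: Id (ID _ _ bc ab).
apply/mvle_subl; rewrite mvplusA.
apply: (@mvle_trans _ (b ⊕ (a ⊙ mvneg b))); first exact: mvle_addsub.
by apply: mvle_plus (mvle_refl _); exact: mvle_addsub.
Qed.

Lemma mvle_mod_plus a b c d :
  mvle_mod a b -> mvle_mod c d -> mvle_mod (a ⊕ c) (b ⊕ d).
Proof.
have [_ Id ID] := idI => ab cd; apply: Id (ID _ _ ab cd).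
apply/mvle_subl; rewrite mvplusACA.
by apply: mvle_plus; exact: mvle_addsub.
Qed.

Lemma mvle_mod_neg a b : mvle_mod a b -> mvle_mod (mvneg b) (mvneg a).
Proof. by rewrite /mvle_mod mvnegK mvtimesC. Qed.

Lemma mv_ideal_mul n a : I a -> I (mvmul n a).
Proof.
have [_ _ ID] := idI => Ia; elim: n => [|n IH]; first exact: mv_ideal0.
exact: ID.
Qed.

(** The ideal [J] generated by [I] and [a] is larger than [I], hence everything. So the top element
    is below some [i ⊕ mvmul n a] with [i] in [I], and then ¬(n a) is below [i]. *)
Lemma mv_maximal_mul a : ~ I a -> exists n, I (mvneg (mvmul n a)).
Proof.
have [[[i0 Ii0] Id ID] _ mI] := maxI => nIa.
pose J := [set y | exists i n, I i /\ mvle y (i ⊕ mvmul n a)].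
have mulD n m : mvmul n a ⊕ mvmul m a = mvmul (n + m) a.
  elim: n => [|n IH]; first by rewrite mvplus0l.
  by rewrite /mvmul !iterS -mvplusA IH.
have idJ : mv_ideal J.
  split.
  - by exists i0, i0, 0%N; split=> //; apply: mvle_plusr.
  - move=> x y xy [i [n [Ii yi]]]; exists i, n; split=> //.
    exact: mvle_trans yi.
  - move=> x y [i [n [Ii xi]]] [j [m [Ij yj]]].
    exists (i ⊕ j), (n + m)%N; split; first exact: ID.
    by rewrite -mulD mvplusACA; apply: mvle_plus.
have IJ : I `<=` J by move=> x Ix; exists x, 0%N; split=> //; apply: mvle_plusr.
have Ja : J a.
  exists mvzero, 1%N; split; first exact: mv_ideal0.
  by rewrite mvplus0l /= mvplus0; apply: mvle_refl.
have [JT|nJT] := pselect (J = setT); last by case: nIa; rewrite -(mI J).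
have [i [n [Ii h]]] : J (mvneg mvzero) by rewrite JT.
exists n; apply: Id Ii; rewrite -[mvneg (mvmul _ _)]mvtimes1 mvtimesC.
by apply/mvle_subl; rewrite mvplusC.
Qed.

(** Maximal ideals are prime. If both inequalities failed, multiples of [a ⊙ ¬b] and of [b ⊙ ¬a]
    would both be 1 modulo [I]; but these multiples are disjoint by prelinearity, so 1 would lie in
    [I]. *)
Lemma mvle_mod_total a b : mvle_mod a b \/ mvle_mod b a.
Proof.
have [[_ Id ID] IT _] := maxI.
apply: contrapT => /not_orP[] /mv_maximal_mul[n In] /mv_maximal_mul[m Im].
move/(mv_ideal_proper idI): IT; apply; apply: Id (ID _ _ In Im).
set p := a ⊙ mvneg b in In *; set q := b ⊙ mvneg a in Im *.
have pq : mvmeet (mvmul n p) (mvmul m q) = mvzero.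
  apply: mvmeet_mul; rewrite mvmeetC; apply: mvmeet_mul; rewrite mvmeetC.
  exact: mv_prelinear.
rewrite -pq /mvmeet /mvtimes mvnegK.
apply: mvle_plus (mvle_refl _) _; apply: mvle_neg.
by rewrite mvplusC; exact: mvle_plusr.
Qed.

End MaximalQuotient.

(** * Homomorphisms into [0, 1] and their compatibility with scalars *)

Lemma half_expn_lt (R : realType) (e : R) : 0 < e -> exists n, 2^-1 ^+ n < e.
Proof.
move=> e0; exists (Num.bound e^-1).
rewrite exprVn invf_plt ?posrE ?exprn_gt0 //.
exact: (upper_nthrootP (leqnn _)).
Qed.

Section Characters.
Variables (R : realType) (A : mvAlgType).

(** The homomorphisms into the standard MV-algebra [0, 1], with values kept in [R] so that linear
    arithmetic applies; preservation of zero follows in [mv_character0]. *)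
Definition mv_character (f : A -> R) : Prop :=
  [/\ forall a, 0 <= f a <= 1, {morph f : a b / a ⊕ b >-> Num.min (a + b) 1}
    & {morph f : a / mvneg a >-> 1 - a}].

Variable f : A -> R.
Hypothesis hf : mv_character f.
Implicit Types a b : A.

Lemma mv_character_ge0 a : 0 <= f a.
Proof. by have [/(_ a)/andP[]] := hf. Qed.

Lemma mv_character_le1 a : f a <= 1.
Proof. by have [/(_ a)/andP[]] := hf. Qed.

Lemma mv_characterD a b : f (a ⊕ b) = Num.min (f a + f b) 1.
Proof. by have [_ -> _] := hf. Qed.

Lemma mv_characterN a : f (mvneg a) = 1 - f a.
Proof. by have [_ _ ->] := hf. Qed.

Lemma mv_character0 : f mvzero = 0.
Proof.
have := mv_characterD (mvneg mvzero) mvzero; rewrite mvplus0 mv_characterN.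
by rewrite subrK minxx; lra.
Qed.

Lemma mv_character_times a b : f (a ⊙ b) = Num.max (f a + f b - 1) 0.
Proof.
rewrite mv_characterN mv_characterD !mv_characterN.
by case: (leP (1 - f a + _) 1) => ?; case: (leP (f a + f b - 1) 0) => ?; lra.
Qed.

Lemma mv_character_sub a b : f (a ⊙ mvneg b) = Num.max (f a - f b) 0.
Proof. by rewrite mv_character_times mv_characterN; congr Num.max; lra. Qed.

Lemma mv_character_le a b : mvle a b -> f a <= f b.
Proof.
move=> ab; have := mv_character_sub a b.
by rewrite ab mv_character0; case: (leP (f a - f b) 0) => ? ?; lra.
Qed.

Lemma mv_character_meet_gt0 a b : 0 < f (mvmeet a b) <-> 0 < f a /\ 0 < f b.
Proof.
rewrite /mvmeet mv_character_times mv_characterD mv_characterN.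
have := mv_character_ge0 a; have := mv_character_ge0 b.
have := mv_character_le1 a; have := mv_character_le1 b.
by case: (leP (1 - f a + f b) 1) => ?; case: (leP (f a + _ - 1) 0) => ? ? ? ? ?;
  split; lra.
Qed.

End Characters.

Section CharacterScale.
Variables (R : realType) (V : rieszMVType R) (f : V -> R).
Hypothesis hf : mv_character f.
Implicit Types (r q : {i01 R}) (v : V).

Lemma mvscale_subE (r q s : {i01 R}) v :
  s%:num = Num.max (r%:num - q%:num) 0 ->
  mvscale s v = mvscale r v ⊙ mvneg (mvscale q v).
Proof. by move=> srq; rewrite -mvscale_subl; congr mvscale; exact: val_inj. Qed.

Lemma mvscale_zero z v : z%:num = 0 :> R -> mvscale z v = mvzero.
Proof.
move=> z0; rewrite (@mvscale_subE z z z); last by rewrite subrr maxxx.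
exact: mvle_refl.
Qed.

Lemma mvscale_le r q v : r%:num <= q%:num -> mvle (mvscale r v) (mvscale q v).
Proof.
move=> rq; rewrite /mvle -mvscale_subl mvscale_zero //=.
by rewrite max_r // subr_le0.
Qed.

Lemma mv_character_scaleB (r q s : {i01 R}) v : s%:num = r%:num - q%:num ->
  f (mvscale s v) = f (mvscale r v) - f (mvscale q v).
Proof.
move=> srq; have s0 : 0 <= s%:num := ge0 s.
have rq : q%:num <= r%:num by rewrite -subr_ge0 -srq.
have srq' : s%:num = Num.max (r%:num - q%:num) 0 by rewrite -srq max_l.
rewrite (mvscale_subE _ srq') (mv_character_sub hf) max_l // subr_ge0.
by apply: (mv_character_le hf); apply: mvscale_le.
Qed.

(* The defect is additive in [r] and vanishes at [1], so its supremum over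
   [0, 1] is at most half of itself. *)
Lemma mv_character_scale (r : {i01 R}) v : f (mvscale r v) = r%:num * f v.
Proof.
have v0 := mv_character_ge0 hf v; have v1 := mv_character_le1 hf v.
have bnd n : forall q : {i01 R}, `|f (mvscale q v) - q%:num * f v| <= 2^-1 ^+ n.
  elim: n => [|n IH] q.
    have q0 : 0 <= q%:num * f v by rewrite mulr_ge0.
    have q1 : q%:num * f v <= 1 by rewrite mulr_ile1.
    have := mv_character_ge0 hf (mvscale q v).
    have := mv_character_le1 hf (mvscale q v).
    by rewrite expr0 ler_norml; lra.
  have half t : t%:num <= 2^-1 :> R ->
      `|f (mvscale t v) - t%:num * f v| <= 2^-1 ^+ n.+1.
    move=> t2; have d0 : 0 <= t%:num + t%:num by rewrite addr_ge0.
    have d1 : t%:num + t%:num <= 1 by lra.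
    have := IH (Itv01 d0 d1).
    have := @mv_character_scaleB (Itv01 d0 d1) t t v.
    rewrite /= addrK => /(_ erefl) e.
    have -> : f (mvscale (Itv01 d0 d1) v) = f (mvscale t v) + f (mvscale t v).
      by rewrite [X in _ = X + _]e subrK.
    by rewrite exprS !ler_norml mulrDl; lra.
  have [|q2] := leP q%:num 2^-1; first exact: half.
  have d0 : 0 <= 1 - q%:num by rewrite subr_ge0.
  have d1 : 1 - q%:num <= 1 by rewrite gerBl.
  have := half (Itv01 d0 d1).
  rewrite (@mv_character_scaleB 1%:i01 q _ v) //= mvscale1.
  by rewrite !ler_norml => h; have {h} := h ltac:(lra); lra.
apply: contrapT => /eqP; rewrite -subr_eq0 -normr_gt0 => /half_expn_lt[n].
by rewrite ltNge bnd.
Qed.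

End CharacterScale.

(** * Multiples of the top element by real numbers *)

Section Constants.
Variables (R : realType) (V : rieszMVType R).
Implicit Types r q : R.

Definition clamp r : R := Num.max 0 (Num.min r 1).

Lemma clamp_ge0 r : 0 <= clamp r.
Proof. by rewrite le_max lexx. Qed.

Lemma clamp_le1 r : clamp r <= 1.
Proof. by rewrite ge_max ler01 ge_min lexx orbT. Qed.

Lemma clamp_id r : 0 <= r -> r <= 1 -> clamp r = r.
Proof. by move=> r0 r1; rewrite /clamp min_l ?max_r. Qed.

Lemma clamp_0 r : r <= 0 -> clamp r = 0.
Proof. by move=> r0; rewrite /clamp max_l // ge_min r0. Qed.

Lemma clamp_1 r : 1 <= r -> clamp r = 1.
Proof. by move=> r1; rewrite /clamp min_r // max_r. Qed.

Lemma clamp_le r q : r <= q -> clamp r <= clamp q.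
Proof.
move=> rq; have [q0|q0] := leP q 0.
  by rewrite clamp_0 ?clamp_ge0 // (le_trans rq).
have [r0|r0] := leP r 0; first by rewrite clamp_0 ?clamp_ge0.
have [q1|q1] := leP 1 q; first by rewrite (clamp_1 q1) clamp_le1.
by rewrite !clamp_id; lra.
Qed.

Lemma clampN r : clamp (1 - r) = 1 - clamp r.
Proof.
have [r0|r0] := leP r 0; first by rewrite (clamp_0 r0) clamp_1; lra.
have [r1|r1] := leP 1 r; first by rewrite (clamp_1 r1) clamp_0; lra.
by rewrite !clamp_id; lra.
Qed.

(* [r 1], with [r] clamped so that [mvconst] is total on the reals. *)
Definition mvconst r : V :=
  mvscale (Itv01 (clamp_ge0 r) (clamp_le1 r)) (mvneg mvzero).

Lemma mvconst_sub r q :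
  mvconst r ⊙ mvneg (mvconst q) = mvconst (clamp r - clamp q).
Proof.
rewrite /mvconst [RHS](@mvscale_subE _ _ (Itv01 (clamp_ge0 r) (clamp_le1 r))
  (Itv01 (clamp_ge0 q) (clamp_le1 q))) //=.
have h : clamp r - clamp q <= 1.
  by have := clamp_le1 r; have := clamp_ge0 q; lra.
by rewrite {1}/clamp (min_l h) maxC.
Qed.

Lemma mvconst_clamp r : mvconst (clamp r) = mvconst r.
Proof.
congr mvscale; apply: val_inj => /=.
by rewrite clamp_id ?clamp_ge0 ?clamp_le1.
Qed.

Lemma mvconst_le0 r : r <= 0 -> mvconst r = mvzero.
Proof. by move=> r0; apply: mvscale_zero => /=; rewrite clamp_0. Qed.

Lemma mvconst_ge1 r : 1 <= r -> mvconst r = mvneg mvzero.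
Proof.
move=> r1; rewrite -[RHS](@mvscale1 R V); congr mvscale.
by apply: val_inj => /=; rewrite clamp_1.
Qed.

Lemma mvconstN r : mvneg (mvconst r) = mvconst (1 - r).
Proof.
rewrite -[LHS]mvtimes1 mvtimesC -{1}(@mvconst_ge1 1) // mvconst_sub.
by rewrite (@clamp_1 1) // -clampN mvconst_clamp.
Qed.

Lemma mvconst_le r q : r <= q -> mvle (mvconst r) (mvconst q).
Proof.
move=> rq; rewrite /mvle mvconst_sub mvconst_le0 // subr_le0.
exact: clamp_le.
Qed.

Lemma mvconstD r q : mvconst r ⊕ mvconst q = mvconst (clamp r + clamp q).
Proof.
have -> : mvconst r ⊕ mvconst q = mvneg (mvconst (1 - r) ⊙ mvneg (mvconst q)).
  by rewrite -mvconstN /mvtimes !mvnegK.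
by rewrite mvconst_sub mvconstN clampN; congr mvconst; lra.
Qed.

End Constants.

(** * The character of a maximal ideal, and separation of points *)

Section CharacterExistence.
Variables (R : realType) (V : rieszMVType R) (I : set V).
Hypothesis maxI : mv_maximal I.
Implicit Types (a b : V) (r q : R).
Local Notation const := (@mvconst R V).
Local Notation "a <=_I b" := (mvle_mod I a b) (at level 70).

Let lowT := mvle_mod_trans maxI.
Let lowW := mvle_modW maxI.

(** Otherwise the constant [r - q > 0] lies in [I], and by the Archimedean property of the reals one
    of its multiples is 1, so that [I] is not proper. *)
Lemma mvconst_le_mod r q :
  0 <= q -> r <= 1 -> const r <=_I const q -> r <= q.
Proof.
move=> q0 r1 rq; rewrite leNgt; apply/negP => qr.
have [idI IT _] := maxI; move/(mv_ideal_proper idI): IT; apply.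
have t0 : 0 < r - q by lra.
have It : I (const (r - q)).
  by move: rq; rewrite /mvle_mod mvconst_sub !clamp_id //; lra.
have := mv_ideal_mul maxI (Num.bound (r - q)^-1) It.
suff mulE n : mvmul n (const (r - q)) = const ((r - q) *+ n).
  rewrite mulE mvconst_ge1 // -mulr_natl.
  rewrite -[X in X <= _](mulVf (lt0r_neq0 t0)) ler_wpM2r ?(ltW t0) //.
  by apply/ltW/archi_boundP; rewrite invr_ge0 ltW.
elim: n => [|n IH]; first by rewrite mulr0n (mvconst_le0 V (lexx _)).
rewrite [LHS]/= -/(mvmul n _) IH mvconstD mulrS.
have m0 : 0 <= (r - q) *+ n by rewrite mulrn_wge0 // ltW.
have [m1|m1] := leP 1 ((r - q) *+ n).
  by rewrite (clamp_1 m1) !mvconst_ge1 //; have := clamp_ge0 (r - q); lra.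
by rewrite !clamp_id //; lra.
Qed.

(** As in Hölder's theorem, the class of [a] is measured by the cut it makes among the constants.
    The set contains 0 and is bounded by 1, so [sup] is a genuine supremum. *)
Definition quotient_value a : R := sup [set r | 0 <= r <= 1 /\ const r <=_I a].
Local Notation psi := quotient_value.

Let has_sup_psi a : has_sup [set r | 0 <= r <= 1 /\ const r <=_I a].
Proof.
split; last by exists 1 => r [/andP[]].
exists 0; split; first by rewrite lexx ler01.
by rewrite mvconst_le0 //; apply/lowW/mv0le.
Qed.

Lemma quotient_value_ge0 a : 0 <= psi a.
Proof.
apply: (ub_le_sup (proj2 (has_sup_psi a))); split; first by rewrite lexx ler01.
by rewrite mvconst_le0 //; apply/lowW/mv0le.
Qed.

Lemma quotient_value_le1 a : psi a <= 1.
Proof. by apply: (ge_sup (proj1 (has_sup_psi a))) => r [/andP[]]. Qed.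

Lemma lt_quotient_value a r : r < psi a -> const r <=_I a.
Proof.
move=> /(sup_gt (proj1 (has_sup_psi a)))[q [_ qa] rq].
by apply: lowT qa; apply/lowW/mvconst_le/ltW.
Qed.

Lemma gt_quotient_value a r : psi a < r -> a <=_I const r.
Proof.
move=> ar; have [r1|r1] := leP 1 r.
  by rewrite mvconst_ge1 //; apply/lowW/mvneg0_ub.
have [//|ra] := mvle_mod_total maxI a (const r).
have : r <= psi a.
  apply: (ub_le_sup (proj2 (has_sup_psi a))); split=> //.
  by have := quotient_value_ge0 a; lra.
by rewrite leNgt ar.
Qed.

(** Values are computed from strict comparisons on both sides only; nothing has to be known about
    the constant [t] itself. *)
Lemma quotient_valueP a t : 0 <= t <= 1 ->
  (forall r, r < t -> const r <=_I a) -> (forall r, t < r -> a <=_I const r) ->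
  psi a = t.
Proof.
move=> /andP[t0 t1] lo up; apply/eqP; rewrite eq_le; apply/andP; split.
- apply: (ge_sup (proj1 (has_sup_psi a))) => r [/andP[r0 r1] ra].
  apply/ler_addgt0Pr => e e0; apply: mvconst_le_mod => //; first lra.
  by apply: lowT ra _; apply: up; lra.
- apply/ler_addgt0Pr => e e0; have [te|te] := leP (t - e) 0.
    by have := quotient_value_ge0 a; lra.
  rewrite -lerBlDr; apply: (ub_le_sup (proj2 (has_sup_psi a))).
  by split; [lra | apply: lo; lra].
Qed.

(** Both operations are checked on cuts, since constants add and negate like truncated reals. For ⊕
    the distance from [r] to the sum of the values is shared equally between the two summands. *)
Lemma mv_character_quotient_value : mv_character psi.
Proof.
have p0 := quotient_value_ge0; have p1 := quotient_value_le1.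
split=> [a|a b|a]; first by rewrite p0 p1.
- have a0 := p0 a; have b0 := p0 b; apply: quotient_valueP => [|r|r].
  + by rewrite ge_min lexx orbT andbT le_min ler01 addr_ge0.
  + rewrite lt_min => /andP[rab r1].
    pose e := (psi a + psi b - r) / 2.
    have rE : r = (psi a - e) + (psi b - e) by rewrite /e; lra.
    have e0 : 0 < e by rewrite /e; lra.
    apply: (@lowT (const (psi a - e) ⊕ const (psi b - e))).
      apply: lowW; rewrite mvconstD; apply: mvconst_le; rewrite rE.
      have a1 := p1 a; have b1 := p1 b.
      (* [psi a - e] may be negative, in which case clamping only raises it, the harmless direction
         here. *)
      have h x : x <= 1 -> x <= clamp x.
        by move=> x1; rewrite /clamp min_l // le_max lexx orbT.
      by apply: lerD; apply: h; lra.
    by apply: mvle_mod_plus => //; apply: lt_quotient_value; lra.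
  + have [r1 _|r1] := leP 1 r.
      by rewrite mvconst_ge1 //; apply/lowW/mvneg0_ub.
    rewrite gt_min (ltNge 1) (ltW r1) orbF => rab.
    pose e := (r - psi a - psi b) / 2.
    have rE : r = (psi a + e) + (psi b + e) by rewrite /e; lra.
    have e0 : 0 < e by rewrite /e; lra.
    apply: (@lowT (const (psi a + e) ⊕ const (psi b + e))).
      by apply: mvle_mod_plus => //; apply: gt_quotient_value; lra.
    apply: lowW; rewrite mvconstD; apply: mvconst_le.
    by rewrite !clamp_id; lra.
- have := p0 a; have := p1 a => a1 a0; apply: quotient_valueP => [|r ra|r ra].
  + by lra.
  + rewrite -[const r]mvnegK; apply: mvle_mod_neg; rewrite mvconstN.
    by apply: gt_quotient_value; lra.
  + rewrite -[const r]mvnegK; apply: mvle_mod_neg; rewrite mvconstN.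
    by apply: lt_quotient_value; lra.
Qed.

Lemma quotient_value_eq0 a : I a -> psi a = 0.
Proof.
move=> Ia; apply: quotient_valueP; first by rewrite lexx ler01.
- by move=> r r0; rewrite mvconst_le0 ?ltW //; apply/lowW/mv0le.
- move=> r _; have [_ Id _] := let: And3 h _ _ := maxI in h.
  by apply: Id Ia; apply: mvle_timesl.
Qed.

End CharacterExistence.

(** Semisimplicity gives a maximal ideal missing [v]. If its character vanished at [v], it would
    vanish at all multiples of [v], although one of them is 1 modulo the ideal. *)
Lemma mv_character_separation (R : realType) (V : rieszMVType R) (v : V) :
  mv_semisimple V -> v <> mvzero ->
  exists2 f : V -> R, mv_character f & 0 < f v.
Proof.
move=> ssV v0.
have [I maxI nIv] : exists2 I : set V, mv_maximal I & ~ I v.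
  apply: contrapT => h; apply: v0.
  suff : (\bigcap_(I in @mv_maximal V) I) v by rewrite ssV.
  by move=> I maxI; apply: contrapT => nIv; apply: h; exists I.
have cI := mv_character_quotient_value maxI.
exists (@quotient_value R V I) => //; rewrite lt0r (mv_character_ge0 cI) andbT.
apply/eqP => v_eq0; have [n In] := mv_maximal_mul maxI nIv.
have mul0 k : quotient_value I (mvmul k v) = 0.
  elim: k => [|k IH]; first exact: mv_character0 cI.
  by rewrite (mv_characterD cI) v_eq0 -/(mvmul k v) IH addr0 min_l.
have := quotient_value_eq0 maxI In; rewrite (mv_characterN cI) mul0 subr0.
by move/eqP; rewrite oner_eq0.
Qed.

Lemma mv_character_comp (R : realType) (A B : mvAlgType) (h : A -> B)
    (f : B -> R) : mv_hom h -> mv_character f -> mv_character (f \o h).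
Proof.
case=> _ hD hN [f01 fD fN]; split=> [a|a b|a] /=; first exact: f01.
- by rewrite hD fD.
- by rewrite hN fN.
Qed.

Lemma mv_characters_inj (R : realType) (V : rieszMVType R) (v w : V) :
  mv_semisimple V ->
  (forall f : V -> R, mv_character f -> f v = f w) -> v = w.
Proof.
move=> ssV vw.
have le_of (x y : V) : (forall f : V -> R, mv_character f -> f x = f y) ->
    mvle x y.
  move=> xy; apply: contrapT => /(mv_character_separation ssV)[f hf].
  by rewrite (mv_character_sub hf) xy // subrr maxxx ltxx.
by apply: mvle_anti; apply: le_of => // f hf; rewrite vw.
Qed.

(** Characters respect scalars, their composites with [h] are again characters, and they separate
    the points of [W]. *)
Lemma mv_hom_scale (R : realType) (V W : rieszMVType R) (h : V -> W) :
  mv_semisimple W -> mv_hom h ->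
  forall r : {i01 R}, {morph h : v / mvscale r v}.
Proof.
move=> ssW hh r v; apply: mv_characters_inj => // f hf.
rewrite (mv_character_scale hf).
by rewrite -(mv_character_scale (mv_character_comp hh hf)).
Qed.

(** * Controlling characters by the positivity of one element *)

Section Localization.
Variables (R : realType) (A : mvAlgType) (f : A -> R).
Hypothesis hf : mv_character f.
Implicit Types (a b : A) (g : A -> R).

(* Doubling: [a ⊕ a] sees [2 f a] when [f a <= 1/2], and [a ⊙ a] sees
   [2 f a - 1] otherwise; either way the error is halved. *)
Lemma mv_character_localize_ge n a : exists2 b, 0 < f b &
  forall g, mv_character g -> 0 < g b -> f a - 2^-1 ^+ n <= g a.
Proof.
elim: n a => [|n IH] a.
  exists (mvneg mvzero).
    by rewrite (mv_characterN hf) (mv_character0 hf) subr0.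
  move=> g hg _; rewrite expr0.
  by have := mv_character_ge0 hg a; have := mv_character_le1 hf a; lra.
have [a2|a2] := leP (f a) 2^-1.
- have [b fb gb] := IH (a ⊕ a); exists b => // g hg /(gb g hg).
  rewrite (mv_characterD hf) (mv_characterD hg) min_l; last lra.
  by rewrite exprS; case: (leP (g a + g a) 1) => ?; lra.
(* The meet with [a ⊙ a] forces [g (a ⊙ a)] to be positive, hence equal to the untruncated
   [2 g a - 1]. *)
- have [b fb gb] := IH (a ⊙ a); exists (mvmeet b (a ⊙ a)).
    apply/(mv_character_meet_gt0 hf); split=> //.
    by rewrite (mv_character_times hf) lt_max; apply/orP; left; lra.
  move=> g hg /(mv_character_meet_gt0 hg)[/(gb g hg)].
  rewrite (mv_character_times hf) (mv_character_times hg) max_l; last lra.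
  rewrite lt_max ltxx orbF => + ga; rewrite max_l; last exact: ltW.
  by rewrite exprS; lra.
Qed.

(** The lower bounds for [a] and for its negation give the two sides, and the meet of their
    witnesses imposes both. *)
Lemma mv_character_localize a (e : R) : 0 < e -> exists2 b, 0 < f b &
  forall g, mv_character g -> 0 < g b -> `|g a - f a| <= e.
Proof.
move=> /half_expn_lt[n ne].
have [b fb gb] := mv_character_localize_ge n a.
have [c fc gc] := mv_character_localize_ge n (mvneg a).
exists (mvmeet b c); first exact/(mv_character_meet_gt0 hf).
move=> g hg /(mv_character_meet_gt0 hg)[/(gb g hg) + /(gc g hg)].
by rewrite (mv_characterN hf) (mv_characterN hg) ler_norml; lra.
Qed.

End Localization.

(** * Uniqueness of generated semisimple extensions *)

Section GeneratedRelation.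
Variables (R : realType) (A : mvAlgType).

(** The Riesz MV-subalgebra of V × W generated by the diagonal image of [A], as an inductive
    relation, so that arguments go by induction on generation. When [i] and [k] are homomorphisms,
    the pair of zeros comes from the generator [mvzero]. *)
Inductive rmv_relation (V W : rieszMVType R) (i : A -> V) (k : A -> W) :
    V -> W -> Prop :=
| RmvGen a : rmv_relation i k (i a) (k a)
| RmvPlus v v' w w' : rmv_relation i k v w -> rmv_relation i k v' w' ->
    rmv_relation i k (v ⊕ v') (w ⊕ w')
| RmvNeg v w : rmv_relation i k v w -> rmv_relation i k (mvneg v) (mvneg w)
| RmvScale (r : {i01 R}) v w :
    rmv_relation i k v w -> rmv_relation i k (mvscale r v) (mvscale r w).

Lemma rmv_relation_sym (V W : rieszMVType R) (i : A -> V) (k : A -> W) v w :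
  rmv_relation i k v w -> rmv_relation k i w v.
Proof. by elim=> *; constructor. Qed.

Definition rmv_generated (V : rieszMVType R) (i : A -> V) : Prop :=
  forall S : set V, rmv_subalgebra S -> range i `<=` S -> forall v, S v.

Section Functional.
Variables (V W : rieszMVType R) (i : A -> V) (k : A -> W).
Hypotheses (ssV : mv_semisimple V) (ssW : mv_semisimple W).
Hypotheses (hi : mv_hom i) (hk : mv_hom k) (i_inj : injective i).

(** On generators this is localization in [A], for the characters [f \o k] and [g \o i]. Negation
    and scalars do not increase the error; ⊕ adds two errors, hence [e / 2] for each and the meet of
    the witnesses. *)
Lemma rmv_relation_localize (f : W -> R) v w (e : R) :
  mv_character f -> rmv_relation i k v w -> 0 < e -> exists2 b, 0 < f (k b) &
    forall g : V -> R, mv_character g -> 0 < g (i b) -> `|g v - f w| <= e.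
Proof.
move=> hf vw; have hfk := mv_character_comp hk hf.
elim: vw e => {v w} [a|v v' w w' _ IH _ IH'|v w _ IH|r v w _ IH] e e0.
- have [b fb gb] := mv_character_localize hfk a e0; exists b => // g hg.
  exact: gb (mv_character_comp hi hg).
- have e2 : 0 < e / 2 by lra.
  have [b fb gb] := IH _ e2; have [c fc gc] := IH' _ e2.
  exists (mvmeet b c) => [|g hg]; first exact/(mv_character_meet_gt0 hfk).
  move=> /(mv_character_meet_gt0 (mv_character_comp hi hg))[].
  move=> /(gb g hg) + /(gc g hg).
  rewrite (mv_characterD hf) (mv_characterD hg) !ler_norml.
  by case: (leP (g v + g v') 1) => ?; case: (leP (f w + f w') 1) => ?; lra.
- have [b fb gb] := IH _ e0; exists b => // g hg /(gb g hg).
  by rewrite (mv_characterN hf) (mv_characterN hg) !ler_norml; lra.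
- have [b fb gb] := IH _ e0; exists b => // g hg /(gb g hg).
  rewrite (mv_character_scale hf) (mv_character_scale hg) -mulrBr normrM.
  rewrite (ger0_norm (ge0 r)); apply: le_trans.
  by rewrite ler_piMl // le1.
Qed.

Lemma rmv_relation0 w : rmv_relation i k mvzero w -> w = mvzero.
Proof.
move=> r0; apply: contrapT => /(mv_character_separation ssW)[f hf fw].
(* A character [g] of [V] positive at [i b] has value 0 at zero, so this tolerance makes [f w] at
   most half of itself. *)
have e0 : 0 < f w / 2 by lra.
have [b fb gb] := rmv_relation_localize hf r0 e0.
have ib0 : i b <> mvzero.
  have [i0 _ _] := hi; rewrite -i0 => /i_inj b0.
  have [k0 _ _] := hk.
  by move: fb; rewrite b0 k0 (mv_character0 hf) ltxx.
have [g hg /(gb g hg)] := mv_character_separation ssV ib0.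
by rewrite (mv_character0 hg) ler_norml; lra.
Qed.

(** If [v] is related to [x] and to [y], then [v ⊙ ¬v], which is zero, is related to [x ⊙ ¬y]; so
    only the fibre over zero matters. *)
Lemma rmv_relation_fun v w w' :
  rmv_relation i k v w -> rmv_relation i k v w' -> w = w'.
Proof.
move=> vw vw'.
have le_of x y : rmv_relation i k v x -> rmv_relation i k v y -> mvle x y.
  move=> vx vy; apply: rmv_relation0.
  have <- : v ⊙ mvneg v = mvzero by exact: mvle_refl.
  by apply/RmvNeg/RmvPlus; do ?apply: RmvNeg.
by apply: mvle_anti; apply: le_of.
Qed.

Lemma rmv_relation_total : rmv_generated i ->
  forall v, exists w, rmv_relation i k v w.
Proof.
apply; last by move=> _ [a _ <-]; exists (k a); constructor.
split.
- by have [i0 _ _] := hi; exists (k mvzero); rewrite -i0; constructor.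
- by move=> a b [w aw] [w' bw']; exists (w ⊕ w'); constructor.
- by move=> a [w aw]; exists (mvneg w); constructor.
- by move=> r a [w aw]; exists (mvscale r w); constructor.
Qed.

End Functional.

(** By symmetry the relation is total and functional in both directions, hence the graph of a
    bijection; its closure under the operations makes this bijection a homomorphism. *)
Lemma rmv_generated_iso (V W : rieszMVType R) (i : A -> V) (k : A -> W) :
  mv_semisimple V -> mv_semisimple W -> mv_hom i -> mv_hom k ->
  injective i -> injective k -> rmv_generated i -> rmv_generated k ->
  exists eta : V -> W, mv_iso eta /\ forall a, eta (i a) = k a.
Proof.
move=> ssV ssW hi hk i_inj k_inj gi gk.
have [eta etaP] := choice (rmv_relation_total k hi gi).
have [eta' eta'P] := choice (rmv_relation_total i hk gk).
have uniq := rmv_relation_fun ssV ssW hi hk i_inj.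
have uniq' := rmv_relation_fun ssW ssV hk hi k_inj.
have [i0 iD iN] := hi; have [k0 kD kN] := hk.
exists eta; split; last by move=> a; apply: uniq (etaP _) (RmvGen _ _ _).
split.
  split=> [|v w|v]; apply: uniq (etaP _) _.
  - by rewrite -i0 -k0; apply: RmvGen.
  - by apply: RmvPlus.
  - by apply: RmvNeg.
exists eta' => [v|w].
- exact: uniq' (eta'P _) (rmv_relation_sym (etaP v)).
- exact: uniq (etaP _) (rmv_relation_sym (eta'P w)).
Qed.

(** The equalizer of [g] and [h] is a Riesz MV-subalgebra, scalars being preserved by
    [mv_hom_scale]. This gives naturality. *)
Lemma rmv_generated_ext (V W : rieszMVType R) (i : A -> V) (g h : V -> W) :
  mv_semisimple W -> rmv_generated i -> mv_hom g -> mv_hom h ->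
  (forall a, g (i a) = h (i a)) -> g =1 h.
Proof.
move=> ssW gi hg hh gh.
have gZ := mv_hom_scale ssW hg; have hZ := mv_hom_scale ssW hh.
have [g0 gD gN] := hg; have [h0 hD hN] := hh.
apply: (gi [set v | g v = h v]) => [|_ [a _ <-]]; last exact: gh.
split=> /=.
- by rewrite g0 h0.
- by move=> a b ea eb; rewrite gD hD ea eb.
- by move=> a ea; rewrite gN hN ea.
- by move=> r a ea; rewrite gZ hZ ea.
Qed.

End GeneratedRelation.

(** * Injectivity and generation for the hulls *)

Section MVHull.
Variables (R : realType) (A : mvAlgType) (V : rieszMVType R) (iota : A -> V).
Hypothesis hull : mv_hull iota.

Lemma mv_hull_inj : injective iota.
Proof.
have [B [j [M [m [e [[G [D [d [phi [psi []]]]]]]]]]]] := hull.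
move=> [_ d_inj _ _] [_ [phi' phiK phi'K]] [_ [psi' psiK _]] jphi [_ m_inj _ _].
move=> _ _ eiota a b /(congr1 e); rewrite !eiota => /m_inj.
rewrite -[a]phi'K -[b]phi'K !jphi => /(can_inj psiK)/(congr1 val)/d_inj ab.
by congr phi; apply: gamma_eq.
Qed.

(** Generation is given inside the completion [M]. It is pulled back along the injective [e],
    because the image of [S] under [e] is a subalgebra containing the generators. *)
Lemma mv_hull_generated : rmv_generated iota.
Proof.
have [B [j [M [m [e [_ _ [[e0 eD eN] e_inj eZ] rangee eiota]]]]]] := hull.
move=> S [S0 SD SN SZ] Siota v.
suff sub : range e `<=` e @` S by have [w Sw /e_inj <-] := sub _ (imageT e v).
rewrite rangee; apply: smallest_sub => [|_ [a _ <-]]; last first.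
  by exists (iota a); [apply: Siota; exists a | rewrite eiota].
split.
- by exists mvzero.
- by move=> _ _ [x Sx <-] [y Sy <-]; exists (x ⊕ y); [exact: SD | rewrite eD].
- by move=> _ [x Sx <-]; exists (mvneg x); [exact: SN | rewrite eN].
- by move=> r _ [x Sx <-]; exists (mvscale r x); [exact: SZ | rewrite eZ].
Qed.

End MVHull.

Section GroupHull.
Variables (R : realType) (G : lgroupType) (L : rieszType R) (iota : G -> L).
Hypothesis hull : group_hull iota.

Lemma group_hull_inj : injective iota.
Proof.
have [D [d [C [c [e [[_ d_inj _ _] [_ c_inj _ _] _ _ eiota]]]]]] := hull.
by move=> x y /(congr1 e); rewrite !eiota => /c_inj/d_inj.
Qed.

(* The divisible hull enters the generating set only through multiples by
   [1/n], which the hull has as a real vector space. *)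
Lemma group_hull_generated (T : set L) :
  riesz_subspace T -> range iota `<=` T -> forall x, T x.
Proof.
have [D [d [C [c [e]]]]] := hull.
case=> [[_ _ _ divD] [[cD _ _] _ _ _] [[[eD eI eU] eZ] e_inj] rangee eiota].
have eMn n x : e (x *+ n) = e x *+ n by rewrite -!scaler_nat eZ.
have c0 : c 0 = 0 by apply: (addIr (c 0)); rewrite -cD !add0r.
have cMn n y : c (y *+ n) = c y *+ n.
  by elim: n => [|n IH]; rewrite ?mulr0n // !mulrS cD IH.
move=> [T0 TD TZ TI TU] Tiota x.
suff sub : range e `<=` e @` T by have [y Ty /e_inj <-] := sub _ (imageT e x).
rewrite rangee; apply: smallest_sub => [|_ [y _ <-]]; last first.
  have [z _ ez] : range e (c y).
    by rewrite rangee; apply: sub_gen_smallest; exists y.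
  exists z => //; have [n [g [n0 yn]]] := divD y.
  have -> : z = n%:R^-1 *: iota g.
    have <- : z *+ n = iota g by apply: e_inj; rewrite eMn ez -cMn yn eiota.
    by rewrite -scaler_nat scalerA mulVf ?scale1r // pnatr_eq0 -lt0n.
  by apply/TZ/Tiota; exists g.
have e0 : e 0 = 0 by rewrite -(scale0r (0 : L)) eZ scale0r.
split.
- by exists 0.
- by move=> _ _ [a Ta <-] [b Tb <-]; exists (a + b); [exact: TD | rewrite eD].
- by move=> r _ [a Ta <-]; exists (r *: a); [exact: TZ | rewrite eZ].
- move=> _ _ [a Ta <-] [b Tb <-].
  by exists (lgmeet a b); [exact: TI | rewrite eI].
- move=> _ _ [a Ta <-] [b Tb <-].
  by exists (lgjoin a b); [exact: TU | rewrite eU].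
Qed.

End GroupHull.

(** Riesz decomposition: [x] is the sum of [x ∧ u], which lies in the interval, and of
    [(x - u) ∨ 0], whose bound has one [u] fewer. *)
Lemma lg_interval_ind (G : lgroupType) (u : G) (P : G -> Prop) :
  0 <= u -> (forall x, 0 <= x <= u -> P x) ->
  (forall x y, P x -> P y -> P (x + y)) ->
  forall n x, 0 <= x <= u *+ n -> P x.
Proof.
move=> u0 P1 PD; elim=> [|n IH] x /andP[x0 xn].
  by apply: P1; rewrite x0 (le_trans xn) // mulr0n.
rewrite -[x](subrK (lgmeet x u)); apply: PD; last first.
  by apply: P1; rewrite lg_lexI x0 u0 lg_leIr.
apply: IH; rewrite lg_subr_ge0 lg_leIl addrC lg_oppI lg_joinDr addNr.
by rewrite lg_leUx lg_mulrn_ge0 // addrC lg_lerBl -mulrSr.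
Qed.

(** * The Riesz subspace spanned by a subalgebra of the unit interval *)

Section SpannedSubspace.
Variables (R : realType) (L : uaRiesz R) (S : set (gammaR L)).
Hypothesis subS : rmv_subalgebra S.
Local Notation u := (uar_unit L).
Local Notation gval x := (val (x : gammaR L) : L).

(** The linear span of [S]; one scalar and one difference suffice because [S] is closed under convex
    combinations. *)
Definition cone_difference : set L :=
  [set x | exists (l : R) (s t : gammaR L),
     [/\ 0 < l, S s, S t & x = l *: (gval s - gval t)]].

Lemma gammaR_scaleE (r : {i01 R}) (x : gammaR L) :
  gval (mvscale r x) = r%:num *: gval x.
Proof. by []. Qed.

Lemma gammaR_ge0 (x : gammaR L) : 0 <= gval x.
Proof. exact: (@gamma_ge0 (uaGroup_of_uaRiesz L)). Qed.

Lemma gammaR_leu (x : gammaR L) : gval x <= u.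
Proof. exact: (@gamma_leu (uaGroup_of_uaRiesz L)). Qed.

Lemma gammaR_plusE (x y : gammaR L) : gval x + gval y <= u ->
  gval (x ⊕ y) = gval x + gval y.
Proof. exact: lg_meet_l. Qed.

(** The weights [l / (l + m)] and [m / (l + m)] add up to 1, so the ⊕ of the scaled elements stays
    below [u] and is not truncated. *)
Lemma gammaR_convex (l m : R) (s t : gammaR L) : 0 < l -> 0 < m -> S s -> S t ->
  exists2 v, S v & l *: gval s + m *: gval t = (l + m) *: gval v.
Proof.
have [_ SD _ SZ] := subS => l0 m0 Ss St.
have lm0 : 0 < l + m by rewrite addr_gt0.
have r0 : 0 <= l / (l + m) by rewrite divr_ge0 // ltW.
have q0 : 0 <= m / (l + m) by rewrite divr_ge0 // ltW.
have rq1 : l / (l + m) + m / (l + m) = 1 by rewrite -mulrDl divff ?lt0r_neq0.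
have r1 : l / (l + m) <= 1 by lra.
have q1 : m / (l + m) <= 1 by lra.
exists (mvscale (Itv01 r0 r1) s ⊕ mvscale (Itv01 q0 q1) t).
  by apply: SD; apply: SZ.
rewrite gammaR_plusE !gammaR_scaleE /=; last first.
  rewrite -[X in _ <= X]scale1r -rq1 scalerDl.
  by apply: lg_leD; apply: rs_scale_le => //; apply: gammaR_leu.
by rewrite scalerDr !scalerA ![(l + m) * _]mulrC !divfK ?lt0r_neq0.
Qed.

(** The positive part of [s - t] is [s ⊙ ¬t], which stays in [S]; joins and meets reduce to positive
    parts by translation and negation. *)
Lemma riesz_subspace_cone_difference : riesz_subspace cone_difference.
Proof.
have [S0 SD SN SZ] := subS.
have T0 : cone_difference 0.
  by exists 1, mvzero, mvzero; split=> //; rewrite subrr scaler0.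
have TD x y : cone_difference x -> cone_difference y -> cone_difference (x + y).
  move=> [l [s [t [l0 Ss St ->]]]] [m [s' [t' [m0 Ss' St' ->]]]].
  have [v Sv ev] := gammaR_convex l0 m0 Ss Ss'.
  have [w Sw ew] := gammaR_convex l0 m0 St St'.
  exists (l + m), v, w; split=> //; first by rewrite addr_gt0.
  by rewrite [RHS]scalerBr -ev -ew !scalerBr opprD addrACA.
have TZ (a : R) x : cone_difference x -> cone_difference (a *: x).
  move=> [l [s [t [l0 Ss St ->]]]].
  have [a0|a0|->] := ltgtP a 0; last by rewrite scale0r.
  - exists (- a * l), t, s; split=> //; first by rewrite mulr_gt0 ?oppr_gt0.
    by rewrite mulNr scaleNr -scalerN opprB scalerA.
  - by exists (a * l), s, t; rewrite mulr_gt0 // scalerA.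
have Tpos x : cone_difference x -> cone_difference (lgjoin x 0).
  move=> [l [s [t [l0 Ss St ->]]]].
  exists l, (s ⊙ mvneg t), mvzero; split=> //.
    exact: (SN _ (SD _ _ (SN _ Ss) (SN _ (SN _ St)))).
  rewrite -[X in lgjoin _ X](scaler0 _ l) -rs_scale_join ?ltW //.
  by rewrite -(gamma_timesNE s t) subr0.
have TN x : cone_difference x -> cone_difference (- x).
  by rewrite -scaleN1r; apply: TZ.
have TU x y : cone_difference x -> cone_difference y ->
    cone_difference (lgjoin x y).
  move=> Tx Ty; have -> : lgjoin x y = lgjoin (x - y) 0 + y.
    by rewrite lg_joinDr subrK add0r.
  exact: (TD _ _ (Tpos _ (TD _ _ Tx (TN _ Ty))) Ty).
split=> // x y Tx Ty.
rewrite -[lgmeet x y]opprK lg_oppI.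
exact: (TN _ (TU _ _ (TN _ Tx) (TN _ Ty))).
Qed.

(** The span acquires no new element in the unit interval: since [x] is positive, it is a multiple
    [l] of the single element [s ⊙ ¬t] of [S]. *)
Lemma cone_difference_mem (x : gammaR L) : cone_difference (gval x) -> S x.
Proof.
have [S0 SD SN SZ] := subS.
move=> [l [s [t [l0 Ss St xE]]]].
pose s0 := s ⊙ mvneg t.
have Ss0 : S s0 := (SN _ (SD _ _ (SN _ Ss) (SN _ (SN _ St)))).
have {}xE : gval x = l *: gval s0.
  rewrite (gamma_timesNE s t) (rs_scale_join _ 0 (ltW l0)) -xE scaler0.
  by rewrite lg_join_l // gammaR_ge0.
(* As [l] may exceed 1, the scalar used is [l / n], and the factor [n] is recovered as an [n]-fold
   ⊕. *)
pose n := Num.bound l.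
have ln : l < n%:R by apply: archi_boundP; apply: ltW.
have n0 : 0 < n%:R :> R by apply: lt_trans ln.
have r0 : 0 <= l / n%:R by rewrite divr_ge0 // ltW.
have r1 : l / n%:R <= 1 by rewrite ler_pdivrMr // mul1r ltW.
pose y := mvscale (Itv01 r0 r1) s0.
have xn : gval y *+ n = gval x.
  by rewrite gammaR_scaleE /= -scaler_nat scalerA mulrC divfK ?lt0r_neq0.
(* The partial sums lie below [x], hence below [u], so no ⊕ truncates. *)
have yu k : (k <= n)%N -> gval (mvmul k y) = gval y *+ k.
  elim: k => [//|k IH] kn.
  rewrite gammaR_plusE -/(mvmul k y) (IH (ltnW kn)) -mulrS //.
  apply: le_trans (gammaR_leu x); rewrite -xn -(subnK kn) mulrnDr addrC.
  by rewrite lg_lerDl lg_mulrn_ge0 // gammaR_ge0.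
have -> : x = mvmul n y by apply: gamma_eq; rewrite -[LHS]xn -(yu n).
elim: {1}n => [|k IH]; first exact: S0.
by apply: SD => //; apply: SZ.
Qed.

End SpannedSubspace.

(** * The unit interval of the hull of a group *)

Section GammaHull.
Variables (R : realType) (G : uaGroup) (L : uaRiesz R).
Variable iota : uaGroupHom G (uaGroup_of_uaRiesz L).
Hypothesis hull : group_hull (L := L) iota.

Lemma Gamma_mor_hull_inj : injective (Gamma_mor iota).
Proof.
move=> x y /(congr1 val)/(group_hull_inj hull) xy; exact: gamma_eq.
Qed.

(** The span of [S] is a Riesz subspace containing the image of [G], hence all of [L]; by
    [cone_difference_mem], [S] is then the whole unit interval. *)
Lemma Gamma_mor_hull_generated :
  rmv_generated (V := gammaR L) (Gamma_mor iota).
Proof.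
move=> S subS Siota x; apply: (cone_difference_mem subS).
have subT := riesz_subspace_cone_difference subS.
apply: (group_hull_generated hull subT) => _ [g _ <-].
have [_ TD TZ _ _] := subT; have [S0 _ _ _] := subS.
have [u0 su] := uag_strong_unit G.
have [iD _ _] := uaghomP iota.
(* A positive element of [G] is below a multiple of the unit, hence a finite sum of elements of the
   unit interval. *)
have Tpos g' : 0 <= g' -> cone_difference S (iota g').
  move=> g0; have [n gn] := su g'.
  apply: (@lg_interval_ind _ (uag_unit G) (fun g => cone_difference S (iota g))
    u0 _ _ n); last by rewrite g0.
  - move=> y y01; exists 1, (Gamma_mor iota (gamma_elt y01)), mvzero.
    split=> //; first by apply: Siota; exists (gamma_elt y01).
    by rewrite scale1r subr0.
  - by move=> y z; rewrite iD; apply: TD.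
(* An arbitrary [g] is the difference of the positive elements [g + n u] and [n u]. *)
have [n gn] := su (- g).
rewrite -[g](addrK (uag_unit G *+ n)) iD (uaghomN iota) -scaleN1r.
apply: TD; [|apply: TZ]; apply: Tpos; last exact: lg_mulrn_ge0.
by rewrite addrC -lg_lerBl sub0r.
Qed.

End GammaHull.

(** * The natural isomorphism *)

Lemma mv_iso_is_iso (R : realType) (V W : RMVs R) (eta : hom V W) :
  bijective (eta : mvHom _ _) -> is_iso eta.
Proof.
move=> [g etaK gK]; have [e0 eD eN] := mvhomP eta.
have gh : mv_hom g.
  split=> [|a b|a]; apply: (can_inj etaK); rewrite gK.
  - by rewrite e0.
  - by rewrite eD !gK.
  - by rewrite eN gK.
by exists (MVHom gh); split; apply: mvHom_eq => x /=; [exact: etaK | exact: gK].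
Qed.

Theorem theorem5p2 (R : realType)
    (RG : functor AGua (RSua R)) (hRG : group_hull_functor RG)
    (RA : functor MVs (RMVs R)) (hRA : mv_hull_functor RA) :
  naturally_isomorphic (fcomp RA Gamma) (fcomp (GammaR R) RG).
Proof.
have [iG [hullG extG]] := hRG; have [iA [hullA extA]] := hRA.
have ssA (A : ssMV) : mv_semisimple (RA A : ssRieszMV R).
  exact: ssr_semisimple.
(* Both objects are semisimple and generated by an embedded copy of [Gamma G]; the isomorphism is
   recorded with its values on that copy, which determine it. *)
have iso (G : AGua) : exists eta : hom (RA (Gamma G)) (GammaR R (RG G)),
    bijective (eta : mvHom _ _) /\
    forall a, (eta : mvHom _ _) (iA (Gamma G) a) = Gamma_mor (iG G) a.
  have [eta [[eh bij] ea]] := rmv_generated_iso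
    (ssA (Gamma G)) (@gammaR_semisimple R (RG G))
    (mvhomP (iA (Gamma G))) (mvhomP (Gamma_mor (iG G)))
    (mv_hull_inj (hullA _)) (Gamma_mor_hull_inj (hullG G))
    (mv_hull_generated (hullA _)) (Gamma_mor_hull_generated (hullG G)).
  by exists (MVHom eh).
pose eta G := projT1 (cid (iso G)); have etaP G := projT2 (cid (iso G)).
rewrite -/(eta _) in etaP.
exists eta; split=> [G|G H f].
  by have [b _] := etaP G; exact: mv_iso_is_iso b.
have [_ eG] := etaP G; have [_ eH] := etaP H.
(* Naturality is checked on the generating copy of [Gamma G], where both paths send [a] to the image
   of [f a] under [iG H]. *)
apply: mvHom_eq; apply: (rmv_generated_ext (@gammaR_semisimple R (RG H))
  (mv_hull_generated (hullA (Gamma G))) (mvhomP _) (mvhomP _)) => a.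
rewrite /= extA eG eH; apply: gamma_eq.
by rewrite /= extG.
Qed.
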